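(* Let $n>2$. The submodule of $\tau_{RE}$-symmetric tensors in $\mathcal{M}^{*\otimes2}$ (the $(+1)$-eigenspace of $\tau_{RE}$) is generated, as a $\mathcal{U}_q(sl(n))$-module, by the lowest weight vectors $$\{\delta_1+\delta_2+\omega\delta_3,\ \delta_3+\delta_4-\omega\delta_2,\ \delta_5,\ \delta_6,\ \delta_7,\ \delta_8\}.$$ The submodule of $\tau_{RE}$-antisymmetric tensors in $\mathcal{M}^{*\otimes2}$ (the $(-1)$-eigenspace of $\tau_{RE}$) is generated by the lowest weight vectors $$\{\delta_1-\delta_2,\ \delta_3-\delta_4,\ \delta_9,\ \delta_{10}\}.$$
   Context: Scalars: $\mathbb{C}(q)$, with fractional powers of $q$ adjoined when needed; $\omega=q-q^{-1}$. $\mathcal{U}_q(sl(n))$ is the Hopf algebra with generators $H_i,X_i^\pm$ ($1\le i\le n-1$), relations $[H_i,H_j]=0$, $[H_i,X^\pm_i]=\pm2X_i^\pm$, $[H_i,X^\pm_j]=\mp X^\pm_j$ for $|i-j|=1$, $[H_i,X_j^\pm]=0$ for $|i-j|>1$, $[X_i^+,X_j^-]=\delta_{ij}\frac{q^{H_i}-q^{-H_i}}{q-q^{-1}}$, and the quantum Serre relations $(X_i^\pm)^2X_j^\pm-(q+q^{-1})X_i^\pm X_j^\pm X_i^\pm+X_j^\pm(X_i^\pm)^2=0$ for $|i-j|=1$, $[X_i^\pm,X_j^\pm]=0$ for $|i-j|>1$. The coproduct is $\Delta(H_i)=H_i\otimes1+1\otimes H_i$, $\Delta(X_i^\pm)=X_i^\pm\otimes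 q^{-H_i/2}+q^{H_i/2}\otimes X_i^\pm$ (Sweedler notation $x_{(1)}\otimes x_{(2)}\otimes\cdots$ for iterated coproducts), and the antipode, denoted by a bar, is $\bar H_i=-H_i$, $\overline{X_i^\pm}=-q^{\mp1}X_i^\pm$. $\mathcal{M}$ is the algebra of $n\times n$ matrices with units $e^i_j$, $e^i_je^k_l=\delta^k_je^i_l$ (here $\delta^k_j$ is the Kronecker symbol), and $\rho\colon\mathcal{U}_q(sl(n))\to\mathcal{M}$ is the homomorphism $\rho(H_i)=e^i_i-e^{i+1}_{i+1}$, $\rho(X_i^+)=e^i_{i+1}$, $\rho(X_i^-)=e^{i+1}_i$. $\mathcal{M}^*$ is $\mathcal{M}$ with the left action $x\triangleright A=\rho(x_{(2)})A\rho(\overline{x_{(1)}})$, and $\mathcal{M}^{*\otimes 2}$ is $\mathcal{M}^{\otimes2}$ with the left action $x\triangleright(A\otimes B)=\rho(x_{(2)})A\rho(\overline{x_{(1)}})\otimes\rho(x_{(4)})B\rho(\overline{x_{(3)}})$. Vectors in $\mathcal{M}^{*\otimes2}$ (sums over $1,\dots,n$): $\delta_1=\sum_i q^{-2i+1}e^i_i\otimes e^n_1$; $\delta_2=\sum_i e^n_1\otimes q^{-2i+1}e^i_i$; $\delta_3=\sum_i e^i_1\otimes e^n_i$; $\delta_4=\sum_i a_i\,e^n_i\otimes e^i_1$ with $a_1=1$, $a_i=q^{-(2i-1)}$ for $1<i<n$, $a_n=q^{-2n}$; $\delta_5=\sum_{i,k}q^{-(2i-1)}q^{-(2k-1)}e^i_i\otimes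 e^k_k$; $\delta_6=\sum_{i,k}q^{-(2i-1)}e^k_i\otimes e^i_k$; $\delta_7=q\,e^n_1\otimes e^{n-1}_2+q^{-1}e^{n-1}_2\otimes e^n_1-e^{n-1}_1\otimes e^n_2-e^n_2\otimes e^{n-1}_1$; $\delta_8=e^n_1\otimes e^n_1$; $\delta_9=e^n_1\otimes e^{n-1}_1-q^{-1}e^{n-1}_1\otimes e^n_1$; $\delta_{10}=e^n_1\otimes e^n_2-q^{-1}e^n_2\otimes e^n_1$. The involution $\tau_{RE}$. Let $V=\mathbb{C}^n$ have basis $e_i$ and $V^*$ the dual basis $f^i$; identify $\mathcal{M}^*$ with $V\otimes V^*$ by $e_j\otimes f^i\leftrightarrow e^i_j$. Let $\tau_{V\otimes V}(e_i\otimes e_i)=e_i\otimes e_i$, $\tau_{V\otimes V}(e_i\otimes e_j)=\mathrm{sign}(j-i)\frac{1-q^2}{1+q^2}e_i\otimes e_j+\frac{2q}{1+q^2}e_j\otimes e_i$ ($i\ne j$); $\tau_{V^*\otimes V^*}(f^i\otimes f^i)=f^i\otimes f^i$, $\tau_{V^*\otimes V^*}(f^i\otimes f^j)=\mathrm{sign}(i-j)\frac{1-q^2}{1+q^2}f^i\otimes f^j+\frac{2q}{1+q^2}f^j\otimes f^i$ ($i\neq j$); and $\tau_{V\otimes V^*}\colon V\otimes V^*\to V^*\otimes V$, $\tau_{V\otimes V^*}(e_j\otimes f^i)=q^{-1/n}f^i\otimes e_j$ ($i\ne j$), $\tau_{V\otimes V^*}(e_i\otimes f^i)=q^{-1/n}(qf^i\otimes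 e_i+\omega\sum_{k>i}f^k\otimes e_k)$. On $V\otimes V^*\otimes V\otimes V^*$, $$\tau_{RE}=(\mathrm{id}\otimes\tau_{V\otimes V^*}\otimes\mathrm{id})(\tau_{V\otimes V}\otimes\tau_{V^*\otimes V^*})(\mathrm{id}\otimes\tau_{V\otimes V^*}^{-1}\otimes\mathrm{id}).$$
   Formalization: For n = 3 the vector δ_7 is dropped from the list of generators of the symmetric submodule, because there it is not a lowest weight vector (it is not in the span of δ_1,…,δ_4); for n > 3 the list is as stated. *)

(* Defs.v *)
From HB Require Import structures.
From mathcomp Require Import all_boot all_order all_algebra.
From mathcomp Require Import mxtens complex.
From mathcomp Require Import reals.

Set Implicit Arguments.
Unset Strict Implicit.
Unset Printing Implicit Defensive.

Import GRing.Theory.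
Local Open Scope ring_scope.

(* C(q) with fractional powers of q adjoined: the field C(t) of rational
   functions over C = R[i], where t plays the role of q^(1/2n). *)
Notation CCt R := {fraction {poly R[i]}} (only parsing).
Definition tvar (R : realType) : CCt R := tofrac 'X.

Section Scalars.
Variables (K : fieldType) (n : nat) (t : K).

Definition qq : K := t ^+ (2 * n).
Definition qhalf : K := t ^+ n.
Definition qroot : K := t ^+ 2.
Definition omega : K := qq - qq^-1.

End Scalars.

(* Elements of U_q(sl(n)), represented by noncommutative polynomial
   expressions in the generators; 'I_n.-1 encodes the index 1 <= i <= n - 1 of
   the generators as i.+1.
     UK true i  = q^(H_i/2)      UK false i = q^(-H_i/2)
     UX true i  = X_i^+          UX false i = X_i^-
   Only the action on M* (x) M* is used below, and the defining relations of
   U_q(sl(n)) hold in that action, so that expressions which are equal in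
   U_q(sl(n)) act in the same way, and U_q(sl(n))-submodules are the subspaces
   stable under all expressions. *)
Inductive uq (K : Type) (n : nat) : Type :=
| UC of K
| UH of 'I_n.-1
| UK of bool & 'I_n.-1
| UX of bool & 'I_n.-1
| UAdd of uq K n & uq K n
| UMul of uq K n & uq K n.

Arguments UC {K n}.
Arguments UH {K n}.
Arguments UK {K n}.
Arguments UX {K n}.

Section HopfAlgebra.
Variables (K : fieldType) (n : nat) (t : K).
Local Notation q := (qq n t).
Local Notation qh := (qhalf n t).
Local Notation U := (uq K n).

(* An element of U (x) U is a finite formal sum of pairs: Delta x lists the
   terms x_(1) (x) x_(2). *)
Fixpoint Delta (x : U) : seq (U * U) :=
  match x with
  | UC c => [:: (UC c, UC 1)]
  | UH i => [:: (UH i, UC 1); (UC 1, UH i)]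
  | UK s i => [:: (UK s i, UK s i)]
  | UX s i => [:: (UX s i, UK false i); (UK true i, UX s i)]
  | UAdd y z => Delta y ++ Delta z
  | UMul y z => [seq (UMul a.1 b.1, UMul a.2 b.2) | a <- Delta y, b <- Delta z]
  end.

(* The terms x_(1) (x) x_(2) (x) x_(3) (x) x_(4), as
   (Delta (x) Delta) o Delta. *)
Definition Delta4 (x : U) : seq ((U * U) * (U * U)) :=
  flatten [seq [seq (a, b) | a <- Delta p.1, b <- Delta p.2] | p <- Delta x].

Fixpoint antipode (x : U) : U :=
  match x with
  | UC c => UC c
  | UH i => UMul (UC (-1)) (UH i)
  | UK s i => UK (~~ s) i
  | UX true i => UMul (UC (- q^-1)) (UX true i)
  | UX false i => UMul (UC (- q)) (UX false i)
  | UAdd y z => UAdd (antipode y) (antipode z)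
  | UMul y z => UMul (antipode z) (antipode y)
  end.

(* The matrix unit e^i_j, in row i and column j, both counted from 1. *)
Definition e_ (i j : nat) : 'M[K]_n :=
  \matrix_(a, b) ((a.+1 == i) && (b.+1 == j))%:R.

(* q^(H_i/2) is sent to the exponential q^(rho(H_i)/2) of a diagonal matrix. *)
Fixpoint rho (x : U) : 'M[K]_n :=
  match x with
  | UC c => c%:M
  | UH i => e_ i.+1 i.+1 - e_ i.+2 i.+2
  | UK s i =>
      let c := if s then qh else qh^-1 in
      diag_mx (\row_(a < n)
        (if a.+1 == i.+1 then c else if a.+1 == i.+2 then c^-1 else 1))
  | UX true i => e_ i.+1 i.+2
  | UX false i => e_ i.+2 i.+1
  | UAdd y z => rho y + rho z
  | UMul y z => rho y *m rho z
  end.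

(* M (x) M is 'M_(n * n) through the Kronecker product A *t B, so that
     (C *t D) *m (A *t B) *m (C' *t D') = (C *m A *m C') *t (D *m B *m D'). *)
Definition act (x : U) (T : 'M[K]_(n * n)) : 'M[K]_(n * n) :=
  \sum_(s <- Delta4 x)
     (rho s.1.2 *t rho s.2.2) *m T
     *m (rho (antipode s.1.1) *t rho (antipode s.2.1)).

Definition submodule (W : {vspace 'M[K]_(n * n)}) : Prop :=
  forall (x : U) (T : 'M[K]_(n * n)), T \in W -> act x T \in W.

Definition generates (S : seq 'M[K]_(n * n)) (W : {vspace 'M[K]_(n * n)}) :
    Prop :=
  [/\ submodule W, {subset S <= W} &
      forall W' : {vspace 'M[K]_(n * n)},
        submodule W' -> {subset S <= W'} -> (W <= W')%VS].

Definition lowest_weight (T : 'M[K]_(n * n)) : Prop :=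
  [/\ T != 0,
      exists wt : 'I_n.-1 -> K, forall i, act (UH i) T = wt i *: T &
      forall i, act (UX false i) T = 0].

End HopfAlgebra.

(* K ^ I, with its canonical basis indexed by the finite type I. *)
Section Tensors.
Variable K : fieldType.

Definition kfun (I : finType) := {ffun I -> K^o}.
HB.instance Definition _ (I : finType) := Vector.on (kfun I).

Definition bvec (I : finType) (x : I) : kfun I := [ffun y => (y == x)%:R].

Section LinearExtension.
Variables (I : finType) (W : vectType K) (f : I -> W).

Definition lext_fun (v : kfun I) : W := \sum_x (v x : K) *: f x.

Fact lext_fun_is_linear : linear lext_fun.
Proof.
move=> a u v; rewrite /lext_fun scaler_sumr -big_split /=.
by apply: eq_bigr => x _; rewrite !ffunE scalerDl scalerA.
Qed.

HB.instance Definition _ :=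
  GRing.isLinear.Build K (kfun I) W *:%R lext_fun lext_fun_is_linear.

Definition lext : 'Hom(kfun I, W) := linfun lext_fun.

Lemma lext_bvec x : lext (bvec x) = f x.
Proof.
rewrite lfunE /= /lext_fun (bigD1 x) //= ffunE eqxx scale1r big1 ?addr0 //.
by move=> y /negPf nyx; rewrite ffunE nyx scale0r.
Qed.

End LinearExtension.

Definition tens (I J : finType) (u : kfun I) (v : kfun J) : kfun (I * J)%type :=
  [ffun p => u p.1 * v p.2].

Definition tens_lfun (I I' J J' : finType)
    (f : 'Hom(kfun I, kfun I')) (g : 'Hom(kfun J, kfun J')) :
    'Hom(kfun (I * J)%type, kfun (I' * J')%type) :=
  lext (fun p => tens (f (bvec p.1)) (g (bvec p.2))).

(* id (x) f (x) id on a fourfold tensor product. *)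
Definition mid_lfun (I : finType)
    (f : 'Hom(kfun (I * I)%type, kfun (I * I)%type)) :
    'Hom(kfun ((I * I) * (I * I))%type, kfun ((I * I) * (I * I))%type) :=
  lext (fun p => \sum_(y : I * I)
    (f (bvec (p.1.2, p.2.1)) y : K) *: bvec ((p.1.1, y.1), (y.2, p.2.2))).

End Tensors.

Section TauRE.
Variables (K : fieldType) (n : nat) (t : K).
Local Notation q := (qq n t).
Local Notation w := (omega n t).
Local Notation T2 := (kfun K ('I_n * 'I_n)%type).
Local Notation T4 := (kfun K (('I_n * 'I_n) * ('I_n * 'I_n))%type).
Local Notation b := (bvec K).

Definition sgn_lt (i j : nat) : K := if (i < j)%N then 1 else -1.

(* bvec (i, j) is e_i (x) e_j. *)
Definition tau_VV : 'End(T2) :=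
  lext (fun p : 'I_n * 'I_n => let: (i, j) := p in
    if i == j then b (i, i)
    else (sgn_lt i j * ((1 - q ^+ 2) / (1 + q ^+ 2))) *: b (i, j)
         + (2 * q / (1 + q ^+ 2)) *: b (j, i)).

(* bvec (i, j) is f^i (x) f^j. *)
Definition tau_WW : 'End(T2) :=
  lext (fun p : 'I_n * 'I_n => let: (i, j) := p in
    if i == j then b (i, i)
    else (sgn_lt j i * ((1 - q ^+ 2) / (1 + q ^+ 2))) *: b (i, j)
         + (2 * q / (1 + q ^+ 2)) *: b (j, i)).

(* bvec (j, i) is e_j (x) f^i in the source, f^j (x) e_i in the target. *)
Definition tau_VW : 'End(T2) :=
  lext (fun p : 'I_n * 'I_n => let: (j, i) := p in
    (qroot t)^-1 *:
      (if i == j then q *: b (i, i) + w *: \sum_(k < n | (i < k)%N) b (k, k)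
       else b (i, j))).

(* The identification e_j (x) f^i (x) e_l (x) f^k <-> e^i_j (x) e^k_l. *)
Definition VWVW_to_MM : 'Hom(T4, 'M[K]_(n * n)) :=
  lext (fun p => let: ((j, i), (l, k)) := p in delta_mx i j *t delta_mx k l).

Definition tau_RE : 'End('M[K]_(n * n)) :=
  (VWVW_to_MM \o (mid_lfun tau_VW \o tens_lfun tau_VV tau_WW
                  \o mid_lfun (tau_VW^-1)) \o VWVW_to_MM^-1)%VF.

End TauRE.

Section LowestWeightVectors.
Variables (K : fieldType) (n : nat) (t : K).
Local Notation q := (qq n t).
Local Notation w := (omega n t).
Local Notation e := (e_ K n).
Local Notation MM := 'M[K]_(n * n).

Definition delta1 : MM :=
  \sum_(1 <= i < n.+1) q ^- (2 * i - 1) *: (e i i *t e n 1).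
Definition delta2 : MM :=
  \sum_(1 <= i < n.+1) q ^- (2 * i - 1) *: (e n 1 *t e i i).
Definition delta3 : MM := \sum_(1 <= i < n.+1) e i 1 *t e n i.
Definition coef4 (i : nat) : K :=
  if i == 1%N then 1 else if i == n then q ^- (2 * n) else q ^- (2 * i - 1).
Definition delta4 : MM :=
  \sum_(1 <= i < n.+1) coef4 i *: (e n i *t e i 1).
Definition delta5 : MM :=
  \sum_(1 <= i < n.+1) \sum_(1 <= k < n.+1)
    (q ^- (2 * i - 1) * q ^- (2 * k - 1)) *: (e i i *t e k k).
Definition delta6 : MM :=
  \sum_(1 <= i < n.+1) \sum_(1 <= k < n.+1)
    q ^- (2 * i - 1) *: (e k i *t e i k).
Definition delta7 : MM :=
  q *: (e n 1 *t e n.-1 2) + q^-1 *: (e n.-1 2 *t e n 1)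
  - e n.-1 1 *t e n 2 - e n 2 *t e n.-1 1.
Definition delta8 : MM := e n 1 *t e n 1.
Definition delta9 : MM :=
  e n 1 *t e n.-1 1 - q^-1 *: (e n.-1 1 *t e n 1).
Definition delta10 : MM :=
  e n 1 *t e n 2 - q^-1 *: (e n 2 *t e n 1).

(* delta7 is listed for n > 3 only. For n = 3 its component of M* (x) M* does
   not occur, and the formula for delta7 gives a vector that is neither a lowest
   weight vector nor tau_RE-symmetric. *)
Definition sym_generators : seq MM :=
  [:: delta1 + delta2 + w *: delta3; delta3 + delta4 - w *: delta2;
      delta5; delta6] ++ (if (3 < n)%N then [:: delta7] else [::])
  ++ [:: delta8].

Definition antisym_generators : seq MM :=
  [:: delta1 - delta2; delta3 - delta4; delta9; delta10].

End LowestWeightVectors.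

(* Main.v *)
(** M* (x) M* carries a Hermitian form for which X_i^+ and X_i^- are adjoint and
which has no isotropic vectors, because the conjugation of C(t) fixes t. Hence
submodules have complements, and a submodule is determined by its vectors
killed by all X_i^-.

The map tau_(V (x) V* ) identifies M* (x) M* with V (x) V (x) V* (x) V*. There a
killed vector splits into parts that are symmetric or antisymmetric for
tau_(V (x) V) and tau_(V* (x) V* ), and in each part every equation X_i^- u = 0
has at most two terms, so that zeros propagate from a few coordinates to all of
them. There are as many of these coordinates as generators of the eigenspace of
tau_RE, and the generators are linearly independent, hence they span the killed
vectors of the eigenspace. The same coordinates decide to which eigenspace a
killed vector belongs. *)

From HB Require Import structures.
Require Import Defs.
From mathcomp Require Import all_boot all_order all_algebra.
From mathcomp Require Import generic_quotient.
From mathcomp Require Import mxtens complex reals.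
From mathcomp Require Import ring zify.

Set Implicit Arguments.
Unset Strict Implicit.
Unset Printing Implicit Defensive.

Import Order.TTheory GRing.Theory Num.Theory.
Local Open Scope ring_scope.

(** * Action in coordinates *)

(** The killed vectors of an eigenspace determine only the submodule that they generate; the
    obstacle is to show that it is the whole eigenspace. The form settles this without any
    classification of simple modules. It has no isotropic vectors because, for polynomials p_j in t,
    the first coefficient of the sum of p_j * conj p_j that can be nonzero is a sum of squared
    absolute values. Only here do the scalars have to be C(t); the other computations need just that
    t, 2 and 1 + q^2 are nonzero. The maps [tau_VV] and [tau_WW] square to 1 because (1-q^2)^2 +
    (2q)^2 = (1+q^2)^2. They act on different legs and commute, so the eigenvalue 1 of [tau_RE]
    collects the types symmetric-symmetric and antisymmetric-antisymmetric, and -1 the two mixed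
    types. The decisive coordinates number 3 + 3 (3 + 2 for n = 3, where two of them coincide) and 2
    + 2. The value of [tau_RE] on a generator v is never computed: v minus h times its image, with h
    = 1 or -1, is a killed vector of the opposite eigenspace, so it vanishes as soon as a few of its
    coordinates do. *)

Section Coordinates.
Variables (K : fieldType) (n : nat).
Local Notation MM := 'M[K]_(n * n).

(* The coefficient of e^i_j (x) e^k_l, that is, of e_j (x) f^i (x) e_l (x) f^k. *)
Definition ent (T : MM) (j i l k : 'I_n) : K :=
  T (mxtens_index (i, k)) (mxtens_index (j, l)).

Definition of_ent (f : 'I_n -> 'I_n -> 'I_n -> 'I_n -> K) : MM :=
  \matrix_(r, c) f (mxtens_unindex c).1 (mxtens_unindex r).1
                   (mxtens_unindex c).2 (mxtens_unindex r).2.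

Lemma of_entK f j i l k : ent (of_ent f) j i l k = f j i l k.
Proof. by rewrite /ent mxE !mxtens_indexK. Qed.

Lemma entP (S T : MM) :
  (forall j i l k, ent S j i l k = ent T j i l k) <-> S = T.
Proof.
split=> [eqST|-> //]; apply/matrixP=> r c.
by case: (mxtens_indexP r) => i k; case: (mxtens_indexP c) => j l; apply: eqST.
Qed.

Lemma entD S T j i l k : ent (S + T) j i l k = ent S j i l k + ent T j i l k.
Proof. by rewrite /ent mxE. Qed.
Lemma entN T j i l k : ent (- T) j i l k = - ent T j i l k.
Proof. by rewrite /ent mxE. Qed.
Lemma entZ c T j i l k : ent (c *: T) j i l k = c * ent T j i l k.
Proof. by rewrite /ent mxE. Qed.
Lemma ent0 j i l k : ent 0 j i l k = 0.
Proof. by rewrite /ent mxE. Qed.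
Lemma ent_sum (J : Type) (r : seq J) (P : pred J) (F : J -> MM) j i l k :
  ent (\sum_(x <- r | P x) F x) j i l k = \sum_(x <- r | P x) ent (F x) j i l k.
Proof. by rewrite /ent summxE. Qed.
Lemma ent_tens A B j i l k : ent (A *t B) j i l k = A i j * B k l.
Proof. exact: tensmxE. Qed.

Lemma sum_delta (I : finType) (a : I) (F : I -> K) :
  \sum_x (x == a)%:R * F x = F a.
Proof.
rewrite (bigD1 a) //= eqxx mul1r big1 ?addr0 // => x /negPf ->.
by rewrite mul0r.
Qed.

(** The matrices of the generators and of their antipodes have at most one nonzero entry in each row
    and column, so multiplication by them relabels and rescales a single coefficient. A matrix unit
    fits the hypotheses through a constant position function, with an indicator as coefficient. *)
Lemma ent_mul (A1 A2 B1 B2 : 'M[K]_n) T (ca1 ca2 cb1 cb2 : 'I_n -> K)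
    (fa1 fa2 fb1 fb2 : 'I_n -> 'I_n) j i l k :
    (forall x y, A1 x y = (y == fa1 x)%:R * ca1 x) ->
    (forall x y, A2 x y = (y == fa2 x)%:R * ca2 x) ->
    (forall x y, B1 x y = (x == fb1 y)%:R * cb1 y) ->
    (forall x y, B2 x y = (x == fb2 y)%:R * cb2 y) ->
  ent ((A1 *t A2) *m T *m (B1 *t B2)) j i l k =
  ca1 i * ca2 k * cb1 j * cb2 l * ent T (fb1 j) (fa1 i) (fb2 l) (fa2 k).
Proof.
move=> hA1 hA2 hB1 hB2.
have row S i' k' y : ((A1 *t A2) *m S) (mxtens_index (i', k')) y =
    ca1 i' * ca2 k' * S (mxtens_index (fa1 i', fa2 k')) y.
  rewrite mxE (bigD1 (mxtens_index (fa1 i', fa2 k'))) //= big1 ?addr0.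
    by rewrite tensmxE hA1 hA2 !eqxx !mul1r.
  move=> z; case: (mxtens_indexP z) => a b ne; rewrite tensmxE hA1 hA2.
  case: (a =P _) => [Ea|]; last by rewrite !mul0r.
  by case: (b =P _) => [Eb|]; [rewrite Ea Eb eqxx in ne | rewrite mul0r mulr0 mul0r].
rewrite /ent mxE (bigD1 (mxtens_index (fb1 j, fb2 l))) //= big1 ?addr0.
  by rewrite row tensmxE hB1 hB2 !eqxx !mul1r; ring.
move=> z; case: (mxtens_indexP z) => a b ne; rewrite tensmxE hB1 hB2.
case: (a =P _) => [Ea|]; last by rewrite !(mul0r, mulr0).
by case: (b =P _) => [Eb|]; [rewrite Ea Eb eqxx in ne | rewrite mul0r !mulr0].
Qed.

End Coordinates.

Section Indices.
Variable n : nat.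

Fact lo_subproof (p : 'I_n.-1) : (p < n)%N.
Proof. by case: p => p /= ?; lia. Qed.
Fact hi_subproof (p : 'I_n.-1) : (p.+1 < n)%N.
Proof. by case: p => p /= ?; lia. Qed.
Definition lo p : 'I_n := Ordinal (lo_subproof p).
Definition hi p : 'I_n := Ordinal (hi_subproof p).

(* X_p^+ for s = true and X_p^- for s = false send e_src to e_tgt in V, and
   f^tgt to f^src in V*. *)
Definition tgt (s : bool) p : 'I_n := if s then hi p else lo p.
Definition src (s : bool) p : 'I_n := tgt (~~ s) p.

Lemma tgt_neq_src s p : tgt s p != src s p.
Proof. by case: s; rewrite /src -val_eqE /=; lia. Qed.

End Indices.

Section Action.
Variables (K : fieldType) (n : nat) (t : K).
Hypothesis t0 : t != 0.
Local Notation MM := 'M[K]_(n * n).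
Local Notation q := (qq n t).
Local Notation qh := (qhalf n t).
Local Notation I := 'I_n.

Lemma q_neq0 : q != 0. Proof. exact: expf_neq0. Qed.
Lemma qh_neq0 : qh != 0. Proof. exact: expf_neq0. Qed.
Lemma qh2 : qh ^+ 2 = q. Proof. by rewrite /qq /qhalf -exprM mulnC. Qed.

(** The eigenvalue of q^(H_p/2) at the index [tgt s p]. Its square is, up to sign, the factor in the
    antipode of X_p^+ or X_p^-, which lets one formula serve both signs. *)
Definition kappa_tgt (s : bool) : K := if s then qh^-1 else qh.

Lemma kappa_tgt_neq0 s : kappa_tgt s != 0.
Proof. by case: s; rewrite /= ?invr_eq0 qh_neq0. Qed.

(* The diagonal of rho (q^(H_p/2)), the same function for both signs s. *)
Definition kappa s p (x : I) : K :=
  if x == tgt s p then kappa_tgt s else if x == src s p then (kappa_tgt s)^-1 else 1.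

Lemma kappa_tgtE s p : kappa s p (tgt s p) = kappa_tgt s. Proof. by rewrite /kappa
  eqxx. Qed.
Lemma kappa_srcE s p : kappa s p (src s p) = (kappa_tgt s)^-1.
Proof. by rewrite /kappa eq_sym (negPf (tgt_neq_src _ _)) eqxx. Qed.
Lemma kappa_neq0 s p x : kappa s p x != 0.
Proof. by rewrite /kappa; do 2?case: ifP;
  rewrite ?invr_eq0 ?kappa_tgt_neq0 ?oner_neq0. Qed.
Lemma kappa_neg s p x : kappa (~~ s) p x = kappa s p x.
Proof.
rewrite /kappa; have -> : kappa_tgt (~~ s) = (kappa_tgt s)^-1 by case: s;
  rewrite /= ?invrK.
rewrite -/(src s p) [src (~~ s) p]/src negbK invrK.
have [->|//] := eqVneq x (src s p).
by rewrite eq_sym (negPf (tgt_neq_src _ _)).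
Qed.

Lemma e_delta (i j : I) : e_ K n i.+1 j.+1 = delta_mx i j.
Proof. by apply/matrixP=> x y; rewrite !mxE !eqSS !val_eqE. Qed.

Lemma rho_X s (p : 'I_n.-1) x y :
  rho t (UX s p) x y = (y == tgt s p)%:R * (x == src s p)%:R.
Proof.
by case: s; rewrite /= -[p.+2]/(hi p).+1 -[p.+1]/(lo p).+1 e_delta mxE mulrC -natrM mulnb.
Qed.

Lemma rho_SX s (p : 'I_n.-1) x y : rho t (antipode t (UX s p)) x y =
   (x == src s p)%:R * (- kappa_tgt s ^+ 2 * (y == tgt s p)%:R).
Proof.
case: s; rewrite /= -[p.+2]/(hi p).+1 -[p.+1]/(lo p).+1 e_delta mul_scalar_mx mxE mxE
  /kappa_tgt.
  by rewrite exprVn qh2 mulrCA -natrM mulnb.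
by rewrite qh2 mulrCA -natrM mulnb.
Qed.

Lemma rho_K s p x y :
  rho t (UK s p) x y = (y == x)%:R * (if s then kappa false p x else (kappa false p
    x)^-1).
Proof.
rewrite /= !mxE mulr_natl [y == x]eq_sym; congr (_ *+ _).
rewrite /kappa !eqSS /src /= -!val_eqE /=.
by case: s; case: (_ == nat_of_ord p); case: (_ == p.+1); rewrite ?invrK ?invr1.
Qed.

Lemma rho_K' s p x y :
  rho t (UK s p) x y = (x == y)%:R * (if s then kappa false p y else (kappa false p
    y)^-1).
Proof. by rewrite rho_K eq_sym; case: eqP => [->|] //; rewrite !mul0r. Qed.

Lemma kappaF s p x : kappa false p x = kappa s p x.
Proof. by case: s => //; rewrite -kappa_neg. Qed.

Lemma act_X s p T j i l k :
  let g := kappa s p in let a := tgt s p in let b := src s p in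
  ent (act t (UX s p) T) j i l k =
    (j == a)%:R * - kappa_tgt s ^+ 2 * ((g i)^-1 * g l * (g k)^-1) * ent T b i l k
  + (i == b)%:R * ((g j)^-1 * g l * (g k)^-1) * ent T j a l k
  + (l == a)%:R * - kappa_tgt s ^+ 2 * ((g j)^-1 * g i * (g k)^-1) * ent T j i b k
  + (k == b)%:R * ((g j)^-1 * g i * (g l)^-1) * ent T j i l a.
Proof.
move=> g a b; rewrite /act /Delta4 /= !big_cons big_nil addr0 !entD !addrA.
rewrite (ent_mul _ _ _ _ _ (rho_K _ _) (rho_K _ _) (rho_SX _ _) (rho_K' _ _)).
rewrite (ent_mul _ _ _ _ _ (rho_X _ _) (rho_K _ _) (rho_K' _ _) (rho_K' _ _)).
rewrite (ent_mul _ _ _ _ _ (rho_K _ _) (rho_K _ _) (rho_K' _ _) (rho_SX _ _)).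
rewrite (ent_mul _ _ _ _ _ (rho_K _ _) (rho_X _ _) (rho_K' _ _) (rho_K' _ _)).
rewrite /= !(kappaF s) -/g -/a -/b; ring.
Qed.

Definition hwt (p : 'I_n.-1) (x : I) : K := (x == lo p)%:R - (x == hi p)%:R.

Lemma rho_H p x y : rho t (UH p) x y = (y == x)%:R * hwt p x.
Proof.
rewrite /= -[p.+2]/(hi p).+1 -[p.+1]/(lo p).+1 !e_delta !mxE /hwt.
have [->|ne] := eqVneq y x; first by rewrite !andbb mul1r.
have F (c : I) : (x == c) && (y == c) = false.
  by apply/negbTE/andP=> -[/eqP Ex /eqP Ey]; rewrite Ex Ey eqxx in ne.
by rewrite !F subrr mul0r.
Qed.

Lemma rho_SH p x y : rho t (antipode t (UH p)) x y = (x == y)%:R * - hwt p y.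
Proof.
have -> : rho t (antipode t (UH p)) = - rho t (UH p).
  by rewrite /= mul_scalar_mx scaleN1r.
by rewrite [LHS]mxE rho_H eq_sym; have [->|] := eqVneq x y; rewrite ?mul1r ?mul0r ?oppr0.
Qed.
Lemma rho_1 x y : rho t (UC (1 : K) : uq K n) x y = (y == x)%:R * 1.
Proof. by rewrite /= mxE mulr1 eq_sym. Qed.
Lemma rho_1' x y : rho t (UC (1 : K) : uq K n) x y = (x == y)%:R * 1.
Proof. by rewrite rho_1 eq_sym. Qed.

Lemma act_H p T j i l k : ent (act t (UH p) T) j i l k =
  (hwt p i - hwt p j + hwt p k - hwt p l) * ent T j i l k.
Proof.
rewrite /act /Delta4 /= !big_cons big_nil addr0 !entD.
rewrite (ent_mul _ _ _ _ _ rho_1 rho_1 (rho_SH _) rho_1').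
rewrite (ent_mul _ _ _ _ _ (rho_H _) rho_1 rho_1' rho_1').
rewrite (ent_mul _ _ _ _ _ rho_1 rho_1 rho_1' (rho_SH _)).
rewrite (ent_mul _ _ _ _ _ rho_1 (rho_H _) rho_1' rho_1').
ring.
Qed.

Lemma act_K s p T j i l k : ent (act t (UK s p) T) j i l k =
  let g := kappa s p in
  (if s then (g i * g k / g j / g l) else (g j * g l / g i / g k)) * ent T j i l k.
Proof.
rewrite /act /Delta4 /= !big_cons big_nil addr0.
rewrite (ent_mul _ _ _ _ _ (rho_K _ _) (rho_K _ _) (rho_K' _ _) (rho_K' _ _)).
by rewrite !(kappaF s); case: s => /=; ring.
Qed.

Lemma act_C c T : act t (UC c : uq K n) T = c *: T.
Proof.
apply/entP=> j i l k; rewrite entZ /act /Delta4 /= !big_cons big_nil addr0.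
have h x y : rho t (UC c : uq K n) x y = (x == y)%:R * c.
  by rewrite /= mxE mulr_natl.
by rewrite (ent_mul _ _ _ _ _ rho_1 rho_1 h rho_1'); ring.
Qed.

Lemma act_Add x y T : act t (UAdd x y : uq K n) T = act t x T + act t y T.
Proof. by rewrite /act /Delta4 /= map_cat flatten_cat big_cat. Qed.

Lemma actE x T : act t (x : uq K n) T = \sum_(p <- Delta x) \sum_(a <- Delta p.1)
  \sum_(b <- Delta p.2)
     (rho t a.2 *t rho t b.2) *m T
     *m (rho t (antipode t a.1) *t rho t (antipode t b.1)).
Proof.
rewrite /act /Delta4 big_flatten big_map; apply: eq_bigr => p _.
by rewrite big_allpairs_dep.
Qed.

(** [Delta] is multiplicative and [antipode] reverses products, so in each term the matrices of [y]
    stand next to [T] and those of [x] outside. What remains is to interchange the sums over the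
    Sweedler terms. *)
Lemma act_Mul x y T : act t (UMul x y : uq K n) T = act t x (act t y T).
Proof.
rewrite !actE /= big_allpairs_dep; apply: eq_bigr => p _ /=.
under eq_bigr => p' _ do rewrite /= big_allpairs_dep.
rewrite exchange_big; apply: eq_bigr => a _ /=.
under eq_bigr => p' _.
  under eq_bigr => a' _ do rewrite /= big_allpairs_dep /=.
  rewrite exchange_big /=; over.
rewrite exchange_big /=; apply: eq_bigr => b _.
rewrite mulmx_sumr mulmx_suml; apply: eq_bigr => p' _.
rewrite mulmx_sumr mulmx_suml; apply: eq_bigr => a' _.
rewrite mulmx_sumr mulmx_suml; apply: eq_bigr => b' _.
by rewrite -!tensmx_mul !mulmxA.
Qed.

Lemma act_linear x : linear (act t (x : uq K n)).
Proof.
move=> c S T; rewrite /act scaler_sumr -big_split; apply: eq_bigr => s _ /=.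
by rewrite mulmxDr mulmxDl -scalemxAr -scalemxAl.
Qed.

Lemma submodule_gen (W : {vspace MM}) :
    (forall p T, T \in W -> act t (UH p) T \in W) ->
    (forall s p T, T \in W -> act t (UK s p) T \in W) ->
    (forall s p T, T \in W -> act t (UX s p) T \in W) ->
  submodule t W.
Proof.
move=> hH hK hX; elim=> [c|p|s p|s p|x IHx y IHy|x IHx y IHy] T TW; auto.
- by rewrite act_C memvZ.
- by rewrite act_Add memvD ?IHx ?IHy.
- by rewrite act_Mul; apply/IHx/IHy.
Qed.

End Action.

(** * Intertwiners *)

Section TwoLegs.
Variables (K : fieldType) (I : eqType).
Variables (d c : I) (h : I -> K) (gam : K) (sig : I -> I -> K) (s0 c0 eps : K).
Hypotheses (cd : c != d) (gam0 : gam != 0).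
Hypotheses (hd : h d = gam) (hc : h c = gam^-1).
Hypothesis ho : forall x, x != d -> x != c -> h x = 1.
Hypotheses (sdc : sig d c = eps) (scd : sig c d = - eps).
Hypothesis so : forall x, x != d -> x != c ->
  sig x d = sig x c /\ sig d x = sig c x.
Hypotheses (E1 : gam ^+ 2 * (1 + eps * s0) = c0) (E2 : 1 - eps * s0 = gam ^+ 2 * c0).

(* The action of X_p^+ or X_p^- on two legs of the same kind, up to a factor, and
   tau_(V (x) V) or tau_(V* (x) V* ) on them. *)
Definition step2 (v : I -> I -> K) x y :=
  (x == d)%:R * h y * v c y + (y == d)%:R * (h x)^-1 * v x c.
Definition flip2 (v : I -> I -> K) x y :=
  if x == y then v x y else sig x y * s0 * v x y + c0 * v y x.

(** An index other than [d] and [c] has weight 1 and compares in the same way with both, so the flip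
    has equal coefficients before and after the step. When both indices are [d], comparing the
    coefficients of [v c d] and [v d c] gives exactly [E1] and [E2], which also settle the pairs (d,
    c) and (c, d). *)
Lemma flip2_step2 v x y : flip2 (step2 v) x y = step2 (flip2 v) x y.
Proof.
have dc : d != c by rewrite eq_sym.
have F1 : c0 / gam = gam * (1 + eps * s0) by rewrite -E1; field.
have F2 : c0 * gam = (1 - eps * s0) / gam by rewrite E2; field.
rewrite /flip2 /step2.
have [->|xd] := eqVneq x d; have [->|yd] := eqVneq y d; rewrite ?eqxx ?hd.
- rewrite (negPf cd) (negPf dc) sdc scd !mul1r.
  rewrite !mulrDr !mulrA [gam * c0]mulrC [_^-1 * c0]mulrC F1 F2; ring.
- have [->|yc] := eqVneq y c.
    rewrite !hc sdc !mul1r !mul0r !addr0 invrK.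
    by rewrite add0r [c0 * _]mulrA F2; ring.
  rewrite (ho yd yc) !mul0r !mul1r invr1.
  by have [_ ->] := so yd yc; ring.
- rewrite (negPf xd); have [->|xc] := eqVneq x c.
    rewrite !hc scd !mul1r !mul0r !add0r invrK.
    by rewrite addr0 [c0 * _]mulrA F1; ring.
  rewrite (ho xd xc) !mul0r !mul1r ?invr1.
  by have [-> _] := so xd xc; ring.
- by rewrite !mul0r addr0; case: eqP => _; ring.
Qed.

End TwoLegs.

Section Operators.
Variables (K : fieldType) (n : nat) (t : K).
Hypothesis t0 : t != 0.
Hypothesis q2 : 1 + qq n t ^+ 2 != 0.
Local Notation MM := 'M[K]_(n * n).
Local Notation q := (qq n t).
Local Notation w := (omega n t).
Local Notation I := 'I_n.
Local Notation s0 := ((1 - q ^+ 2) / (1 + q ^+ 2)).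
Local Notation c0 := (2 * q / (1 + q ^+ 2)).

Local Notation sg := (fun a b : I => sgn_lt K a b).
Local Notation sg' := (fun a b : I => sgn_lt K b a).

(* Here the coefficient of e_j (x) e_l (x) f^i (x) f^k in a tensor u of
   V (x) V (x) V* (x) V* is stored as [ent u j i l k], in the order of M* (x) M*;
   thus tau_(V (x) V* ) only rescales the coefficients with i <> l. The operators
   opP, opQ, opX and Theta are tau_(V (x) V), tau_(V* (x) V* ), X_p^+ or X_p^-, and
   id (x) tau_(V (x) V* ) (x) id. *)
Definition opP (u : MM) : MM := of_ent (fun j i l k =>
  flip2 sg s0 c0 (fun j l : I => ent u j i l k) j l).
Definition opQ (u : MM) : MM := of_ent (fun j i l k =>
  flip2 sg' s0 c0 (fun i k : I => ent u j i l k) i k).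
Definition opX (s : bool) (p : 'I_n.-1) (u : MM) : MM :=
  let g := kappa t s p in let a := tgt s p in let b := src s p in
  of_ent (fun j i l k =>
    - kappa_tgt n t s ^+ 2 * (g i)^-1 * (g k)^-1 * step2 a b g (fun j l => ent u j i l
        k) j l
    + (g j)^-1 * (g l)^-1 * step2 b a (fun x => (g x)^-1) (fun i k => ent u j i l k) i k).
Definition opD (f : I -> I -> I -> I -> K) (u : MM) : MM :=
  of_ent (fun j i l k => f j i l k * ent u j i l k).

Definition tau_scale := (qroot t)^-1.

Definition Theta (u : MM) : MM := of_ent (fun j i l k => tau_scale *
  if i == l then q * ent u j i i k + w * \sum_(m < n | (m < i)%N) ent u j m m k
  else ent u j i l k).

Lemma ent_Theta u j i l k : ent (Theta u) j i l k = tau_scale *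
  if i == l then q * ent u j i i k + w * \sum_(m < n | (m < i)%N) ent u j m m k
  else ent u j i l k.
Proof. exact: of_entK. Qed.

Lemma tau_scale_neq0 : tau_scale != 0. Proof. by rewrite invr_eq0 expf_neq0. Qed.

Definition ord_sign (s : bool) : K := if s then -1 else 1.

Lemma kappa_tgt_flip s : kappa_tgt n t s ^+ 2 * (1 + ord_sign s * s0) = c0.
Proof.
have Q0 : q != 0 := q_neq0 n t0.
by case: s; rewrite /kappa_tgt /ord_sign ?exprVn (@qh2 _ n t); field; rewrite ?Q0 ?q2.
Qed.
Lemma kappa_tgt_flip' s : 1 - ord_sign s * s0 = kappa_tgt n t s ^+ 2 * c0.
Proof.
have Q0 : q != 0 := q_neq0 n t0.
by case: s; rewrite /kappa_tgt /ord_sign ?exprVn (@qh2 _ n t); field; rewrite ?Q0 ?q2.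
Qed.

Lemma kappa_other s (p : 'I_n.-1) x : x != tgt s p -> x != src s p -> kappa t s p x = 1.
Proof. by rewrite /kappa => /negPf -> /negPf ->. Qed.

Lemma sgn_lt_tgt_src s (p : 'I_n.-1) : sgn_lt K (tgt s p) (src s p) = ord_sign s.
Proof. by rewrite /sgn_lt /src; case: s => /=; rewrite ?ltnSn ?ltnNge ?leqnSn. Qed.
Lemma sgn_lt_src_tgt s (p : 'I_n.-1) : sgn_lt K (src s p) (tgt s p) = - ord_sign s.
Proof. by rewrite /sgn_lt /src; case: s => /=; rewrite ?opprK ?ltnSn ?ltnNge ?leqnSn. Qed.
Lemma sgn_lt_other s (p : 'I_n.-1) (x : I) : x != tgt s p -> x != src s p ->
  sgn_lt K x (tgt s p) = sgn_lt K x (src s p) /\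
  sgn_lt K (tgt s p) x = sgn_lt K (src s p) x.
Proof.
rewrite /sgn_lt /src -!val_eqE => tgt src.
have : (x != p :> nat) && (x != p.+1 :> nat) by case: s tgt src => /= -> ->.
move=> /andP[x1 x2]; case: s {tgt src} => /=; split; congr (if _ then _ else _); lia.
Qed.

(** On the V legs this is [flip2_step2]. The V* part of [opX] is multiplied by a factor symmetric in
    [j] and [l], so it commutes with the flip of these legs. *)
Lemma opP_X s p u : opP (opX s p u) = opX s p (opP u).
Proof.
apply/entP=> j i l k; rewrite !of_entK.
have nab := tgt_neq_src s p; rewrite eq_sym in nab.
have H := flip2_step2 (sig := sg) nab (kappa_tgt_neq0 n t0 s) (kappa_tgtE _ _ _)
  (kappa_srcE _ _ _) (@kappa_other s p) (sgn_lt_tgt_src s p) (sgn_lt_src_tgt s p)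
  (@sgn_lt_other s p) (kappa_tgt_flip s) (kappa_tgt_flip' s).
transitivity (- kappa_tgt n t s ^+ 2 * (kappa t s p i)^-1 * (kappa t s p k)^-1 *
    flip2 sg s0 c0
      (step2 (tgt s p) (src s p) (kappa t s p) (fun j l => ent u j i l k)) j l
  + (kappa t s p j)^-1 * (kappa t s p l)^-1 *
    step2 (src s p) (tgt s p) (fun x => (kappa t s p x)^-1)
      (fun i k => ent (opP u) j i l k) i k).
  rewrite /flip2 !of_entK /step2 !of_entK /flip2; case: (j =P l) => [->|_]; ring.
rewrite H; congr (_ * _ + _); rewrite /step2 !of_entK /flip2; case: (j =P l) => [->|_] //.
Qed.

Lemma opQ_X s p u : opQ (opX s p u) = opX s p (opQ u).
Proof.
apply/entP=> j i l k; rewrite !of_entK.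
have nab := tgt_neq_src s p.
have H := flip2_step2 (sig := sg') (h := fun x => (kappa t s p x)^-1) nab
  (kappa_tgt_neq0 n t0 s)
  (etrans (congr1 _ (kappa_srcE _ _ _)) (invrK _)) (congr1 _ (kappa_tgtE _ _ _))
  (fun x hb ha => etrans (congr1 _ (kappa_other ha hb)) (invr1 _))
  (sgn_lt_tgt_src s p) (sgn_lt_src_tgt s p)
  (fun x hb ha => let: conj e1 e2 := sgn_lt_other ha hb in conj (esym e2) (esym e1))
  (kappa_tgt_flip s) (kappa_tgt_flip' s).
transitivity (- kappa_tgt n t s ^+ 2 * (kappa t s p i)^-1 * (kappa t s p k)^-1 *
    step2 (tgt s p) (src s p) (kappa t s p) (fun j l => ent (opQ u) j i l k) j l
  + (kappa t s p j)^-1 * (kappa t s p l)^-1 *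
    flip2 sg' s0 c0
      (step2 (src s p) (tgt s p) (fun x => (kappa t s p x)^-1)
        (fun i k => ent u j i l k)) i k).
  rewrite /flip2 !of_entK /step2 !of_entK /flip2; case: (i =P k) => [->|_]; ring.
rewrite H; congr (_ + _ * _); rewrite /step2 !of_entK /flip2; case: (i =P k) => [->|_] //.
Qed.

Lemma opP_D f u : (forall j i l k, f j i l k = f l i j k) ->
  opP (opD f u) = opD f (opP u).
Proof.
move=> fE; apply/entP=> j i l k; rewrite !of_entK /flip2 !of_entK (fE l).
by case: eqP => _; ring.
Qed.
Lemma opQ_D f u : (forall j i l k, f j i l k = f j k l i) ->
  opQ (opD f u) = opD f (opQ u).
Proof.
move=> fE; apply/entP=> j i l k; rewrite !of_entK /flip2 !of_entK (fE _ k).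
by case: eqP => _; ring.
Qed.
Lemma Theta_D f u : (forall j i m k, f j i i k = f j m m k) ->
  Theta (opD f u) = opD f (Theta u).
Proof.
move=> fE; apply/entP=> j i l k; rewrite !of_entK.
under eq_bigr => m _ do rewrite !of_entK (fE _ _ i).
by rewrite -mulr_sumr; case: eqP => [->|_]; ring.
Qed.

End Operators.

Section Intertwiner.
Variables (K : fieldType) (n : nat) (t : K).
Hypothesis t0 : t != 0.
Local Notation MM := 'M[K]_(n * n).
Local Notation q := (qq n t).
Local Notation w := (omega n t).
Local Notation I := 'I_n.

(** The two indices are neighbours, so exactly one of them lies below [i] only when [i] is [hi p],
    which is [tgt s p] or [src s p] according to [s]. *)
Lemma sum_ltn_ab s (p : 'I_n.-1) (i : I) :
  \sum_(m < n | (m < i)%N) ((m == src s p)%:R - (m == tgt s p)%:R) =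
  (if s then (i == tgt s p)%:R else - (i == src s p)%:R) :> K.
Proof.
have D (c : I) : \sum_(m < n | (m < i)%N) (m == c)%:R = (c < i)%:R :> K.
  rewrite big_mkcond (bigD1 c) //= eqxx big1 ?addr0; first by case: ifP.
  by move=> m /negPf ->; case: ifP.
rewrite sumrB !D /src; case: s => /=; rewrite -(inj_eq val_inj) /=.
  have [->|ne] := eqVneq (i : nat) p.+1; first by rewrite ltnSn ltnn subr0.
  have -> : (p < i)%N = (p.+1 < i)%N by lia.
  by rewrite subrr.
have [->|ne] := eqVneq (i : nat) p.+1; first by rewrite ltnSn ltnn sub0r.
have -> : (p < i)%N = (p.+1 < i)%N by lia.
  by rewrite subrr oppr0.
Qed.

Lemma q_kappa_tgt s : q = if s then kappa_tgt n t s ^- 2 else kappa_tgt n t s ^+ 2.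
Proof. by case: s; rewrite /kappa_tgt ?exprVn ?invrK (@qh2 _ n t). Qed.

Lemma ent_opX_diag s (p : 'I_n.-1) u j m k :
  let g := kappa t s p in let a := tgt s p in let b := src s p in
  ent (opX t s p u) j m m k =
    (j == a)%:R * - kappa_tgt n t s ^+ 2 * (g k)^-1 * ent u b m m k
  + (g j)^-1 * (k == b)%:R * ent u j m m a
  + kappa_tgt n t s * (g j)^-1 * (g k)^-1 * ent u j a b k * ((m == b)%:R - (m == a)%:R).
Proof.
move=> g a b; rewrite of_entK /step2 -/g -/a -/b.
have ba : b != a by rewrite eq_sym tgt_neq_src.
have gam := kappa_tgt_neq0 n t0 s; have g0 x := kappa_neq0 (n := n) t0 s p x : g x != 0.
have [->|na] := eqVneq m a;
  first by rewrite (negPf (tgt_neq_src _ _)) /g kappa_tgtE /=; field;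
  rewrite ?gam ?(kappa_neq0 t0) ?oner_neq0.
have [->|nb] := eqVneq m b; first by rewrite /g kappa_srcE /=; field;
  rewrite ?gam ?(kappa_neq0 t0) ?oner_neq0.
by rewrite /=; field; rewrite ?(kappa_neq0 t0) ?oner_neq0.
Qed.

(** Away from i = l, [Theta] only rescales. The cases with content are i = l and i = [src s p], l =
    [tgt s p]: there X_p^+ or X_p^- mixes diagonal and off-diagonal coefficients, and [w], the
    difference of q and its inverse, balances the unequal weights of the two neighbouring
    indices. *)
Lemma act_Theta s (p : 'I_n.-1) u :
  act t (UX s p) (Theta t u) = Theta t (opX t s p u).
Proof.
apply/entP=> j i l k; rewrite act_X !ent_Theta.
rewrite [in RHS](eq_bigr _ (fun m _ => ent_opX_diag s p u j m k)) /=.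
rewrite !big_split /= -!mulr_sumr sum_ltn_ab ent_opX_diag.
set g := kappa t s p; set a := tgt s p; set b := src s p; set gam := kappa_tgt n t s.
have ba : b != a by rewrite eq_sym tgt_neq_src.
have ab : a != b by rewrite eq_sym.
have gam0 := kappa_tgt_neq0 n t0 s : gam != 0;
  have g0 x := kappa_neq0 (n := n) t0 s p x : g x != 0.
have ga : g a = gam by exact: kappa_tgtE.
have gb : g b = gam^-1 by exact: kappa_srcE.
have go x : x != a -> x != b -> g x = 1 by exact: kappa_other.
have Q := q_kappa_tgt s; rewrite -/gam in Q.
have W : w = if s then gam ^- 2 - gam ^+ 2 else gam ^+ 2 - gam ^- 2.
  by rewrite /omega Q; case: (s); rewrite ?invrK.
have [<-|il] := eqVneq i l.
  have [Ei|nb] := eqVneq i b; last have [Ei|na] := eqVneq i a.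
  - rewrite Ei !gb W Q.
    by case: (s); rewrite ?(negPf ba) ?(negPf ab) /=; field;
      rewrite ?gam0 ?(kappa_neq0 t0) ?oner_neq0.
  - rewrite Ei !ga W Q.
    by case: (s); rewrite ?(negPf ba) ?(negPf ab) /=; field;
      rewrite ?gam0 ?(kappa_neq0 t0) ?oner_neq0.
  - rewrite (go _ na nb) W Q.
    by case: (s); rewrite ?(negPf ba) ?(negPf ab) /=; field;
      rewrite ?gam0 ?(kappa_neq0 t0) ?oner_neq0.
rewrite of_entK /step2 -/g -/a -/b -/gam.
have [Eib|nib] := eqVneq i b.
  rewrite Eib in il *; rewrite gb.
  have [Ela|nla] := eqVneq l a.
    rewrite Ela ga.
    (* [a] and [b] are neighbours, so the two partial sums differ by one diagonal coefficient. *)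
    have H : w * (\sum_(m < n | (m < b)%N) ent u j m m k) =
             w * (\sum_(m < n | (m < a)%N) ent u j m m k) +
              (if s then - (w * ent u j b b k) else w * ent u j a a k).
      have S (c d : I) : c = d.+1 :> nat -> \sum_(m < n | (m < c)%N) ent u j m m k =
         \sum_(m < n | (m < d)%N) ent u j m m k + ent u j d d k.
        move=> cd; rewrite (bigD1 d) ?cd //= addrC; congr (_ + _).
        by apply: eq_bigl => m; rewrite -val_eqE /=; lia.
      rewrite /a /b /src; case: (s) => /=.
        by rewrite (S (hi p) (lo p)) //; ring.
      by rewrite (S (hi p) (lo p)) //; ring.
    rewrite H W Q.
    by case: (s); rewrite ?(negPf ba) ?(negPf ab) /=; field;
      rewrite ?gam0 ?(kappa_neq0 t0) ?oner_neq0.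
  by rewrite (go l) // 1?eq_sym //; rewrite ?(negPf ba) ?(negPf ab) /=; field;
    rewrite ?gam0 ?(kappa_neq0 t0) ?oner_neq0.
have [Ela|nla] := eqVneq l a.
  rewrite Ela in il *; rewrite (go i il nib) ga.
  by rewrite ?(negPf ba) ?(negPf ab) /=; field; rewrite ?gam0 ?(kappa_neq0 t0) ?oner_neq0.
have [Eia|nia] := eqVneq i a; have [Elb|nlb] := eqVneq l b.
- by rewrite Eia Elb ga gb; rewrite ?(negPf ba) ?(negPf ab) /=; field;
    rewrite ?gam0 ?(kappa_neq0 t0) ?oner_neq0.
- by rewrite Eia ga (go l) //; rewrite ?(negPf ba) ?(negPf ab) /=; field;
    rewrite ?gam0 ?(kappa_neq0 t0) ?oner_neq0.
- by rewrite Elb gb (go i) //; rewrite ?(negPf ba) ?(negPf ab) /=; field;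
    rewrite ?gam0 ?(kappa_neq0 t0) ?oner_neq0.
- by rewrite (go i) // (go l) //; rewrite ?(negPf ba) ?(negPf ab) /=; field;
    rewrite ?gam0 ?(kappa_neq0 t0) ?oner_neq0.
Qed.

End Intertwiner.

(** * Coordinates of linear maps, and tau_RE as a conjugate of two commuting flips *)

Section LinearMaps.
Variable K : fieldType.

Lemma sum_pair (I J : finType) (F : I * J -> K) :
  \sum_p F p = \sum_i \sum_j F (i, j).
Proof. by rewrite pair_bigA; apply: eq_bigr => -[]. Qed.

Lemma lextE (I : finType) (W : vectType K) (f : I -> W) (v : kfun K I) :
  lext f v = \sum_x (v x : K) *: f x.
Proof. by rewrite lfunE. Qed.

Lemma lext_coord (I J : finType) (f : I -> kfun K J) (v : kfun K I) y :
  lext f v y = \sum_x (v x : K) * f x y.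
Proof. by rewrite lextE sum_ffunE; apply: eq_bigr => x _; rewrite ffunE. Qed.

Lemma lfun_coord (I J : finType) (f : 'Hom(kfun K I, kfun K J)) v y :
  f v y = \sum_x (v x : K) * f (bvec K x) y.
Proof.
rewrite -[f in LHS](_ : lext (fun x => f (bvec K x)) = f) ?lext_coord //.
apply/lfunP=> u; rewrite lextE.
have {2}-> : u = \sum_x (u x : K) *: bvec K x.
  apply/ffunP=> x; rewrite sum_ffunE (bigD1 x) //= !ffunE eqxx.
  rewrite big1 ?addr0; first by rewrite [RHS]mulr1.
  by move=> z /negPf nz; rewrite !ffunE eq_sym nz [LHS]mulr0.
by rewrite linear_sum; apply: eq_bigr => x _; rewrite linearZ.
Qed.

Definition slice (I : finType) (v : kfun K ((I * I) * (I * I))%type) (a d : I) :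
    kfun K (I * I)%type :=
  [ffun p => v ((a, p.1), (p.2, d))].

Lemma mid_lfun_coord (I : finType) (f : 'Hom(kfun K (I * I)%type, kfun K (I * I)%type))
  v a b c d :
  mid_lfun f v ((a, b), (c, d)) = f (slice v a d) (b, c).
Proof.
rewrite lext_coord lfun_coord sum_pair [LHS]sum_pair [RHS]sum_pair.
rewrite (bigD1 a) //= [X in _ + X]big1 ?addr0; last first.
  move=> a' na; rewrite big1 // => b' _; rewrite big1 // => -[c' d'] _.
  rewrite sum_ffunE big1 ?[LHS]mulr0 // => y _; rewrite !ffunE /=.
  by rewrite !xpair_eqE /= [a == a']eq_sym (negPf na) [LHS]mulr0.
apply: eq_bigr => b' _; rewrite sum_pair; apply: eq_bigr => c' _.
rewrite [LHS](bigD1 d) //= [X in _ + X]big1 ?addr0; last first.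
  move=> d' nd; rewrite sum_ffunE big1 ?[LHS]mulr0 // => y _; rewrite !ffunE /=.
  by rewrite !xpair_eqE /= [d == d']eq_sym (negPf nd) !andbF [LHS]mulr0.
rewrite ffunE /=; congr (_ * _).
rewrite sum_ffunE (bigD1 (b, c)) //= !ffunE /= !eqxx [X in X + _]mulr1 big1 ?addr0 //.
move=> -[y1 y2] ne; rewrite !ffunE /= !xpair_eqE !eqxx andbT /=.
by rewrite -xpair_eqE eq_sym (negPf ne) [LHS]mulr0.
Qed.

Lemma mid_lfunK (I : finType) (f : 'End(kfun K (I * I)%type)) (v : kfun K ((I * I) * (I
  * I))%type) :
  lker f == 0%VS -> mid_lfun (f^-1)%VF (mid_lfun f v) = v.
Proof.
move=> kf; apply/ffunP=> -[[a b] [c d]]; rewrite mid_lfun_coord.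
have -> : slice (mid_lfun f v) a d = f (slice v a d).
  by apply/ffunP=> -[x y]; rewrite ffunE mid_lfun_coord.
by rewrite lker0_lfunK // ffunE.
Qed.

Lemma tens_lfun_coord (I J : finType) (f : 'End(kfun K I)) (g : 'End(kfun K J)) v x y :
  tens_lfun f g v (x, y) = f [ffun x' => g [ffun y' => v (x', y')] y] x.
Proof.
rewrite lext_coord lfun_coord sum_pair.
apply: eq_bigr => x' _; rewrite ffunE lfun_coord mulr_suml.
by apply: eq_bigr => y' _; rewrite !ffunE /= -mulrA; congr (_ * _); rewrite mulrC.
Qed.

End LinearMaps.

Section TauCoordinates.
Variables (K : fieldType) (n : nat) (t : K).
Hypothesis t0 : t != 0.
Local Notation MM := 'M[K]_(n * n).
Local Notation q := (qq n t).
Local Notation w := (omega n t).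
Local Notation I := 'I_n.
Local Notation T2 := (kfun K ('I_n * 'I_n)%type).
Local Notation T4 := (kfun K (('I_n * 'I_n) * ('I_n * 'I_n))%type).
Local Notation s0 := ((1 - q ^+ 2) / (1 + q ^+ 2)).
Local Notation c0 := (2 * q / (1 + q ^+ 2)).

Lemma lext_flip (sig : I -> I -> K) (v : T2) j l :
  lext (fun p : I * I => let: (i, j) := p in
    if i == j then bvec K (i, i)
    else (sig i j * s0) *: bvec K (i, j) + c0 *: bvec K (j, i)) v (j, l)
  = flip2 sig s0 c0 (fun x y => v (x, y) : K) j l.
Proof.
rewrite lext_coord /flip2.
have [->|ne] := eqVneq j l.
  rewrite (bigD1 (l, l)) //= eqxx ffunE eqxx [X in X + _]mulr1 big1 ?addr0 //.
  move=> [x y]; rewrite xpair_eqE; case: (eqVneq x y) => [->|nxy] ne.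
    by rewrite ffunE xpair_eqE eq_sym; case: eqP ne => //= _ _; rewrite [LHS]mulr0.
  rewrite !ffunE !xpair_eqE.
  rewrite (_ : (l == x) && (l == y) = false) 1?(_ : (l == y) && (l == x) = false).
  - by rewrite ![_ *: _]mulr0 addr0 [LHS]mulr0.
  - by apply: contraNF nxy => /andP[/eqP<- /eqP<-].
  - by apply: contraNF nxy => /andP[/eqP<- /eqP<-].
rewrite (bigD1 (j, l)) //= (negPf ne) !ffunE !xpair_eqE !eqxx (negPf ne) /=.
rewrite (bigD1 (l, j)) /=; last by rewrite xpair_eqE (negPf ne) andbF.
rewrite [l == j]eq_sym (negPf ne) !ffunE !xpair_eqE !eqxx (negPf ne) /=.
rewrite big1 ?addr0 => [|[x y]]; last first.
  rewrite !xpair_eqE => /andP[n1 n2]; case: eqP => [<-|_].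
    rewrite ffunE xpair_eqE (_ : _ && _ = false) ?[LHS]mulr0 //.
    by apply: contraNF ne => /andP[/eqP-> /eqP->].
  rewrite !ffunE !xpair_eqE ![_ == x]eq_sym ![_ == y]eq_sym (negPf n1).
  by rewrite andbC (negPf n2) ![_ *: _]mulr0 addr0 [LHS]mulr0.
by rewrite /GRing.scale /tau_scale /=; ring.
Qed.

Lemma tau_VW_coord (v : T2) i j :
  tau_VW n t v (i, j) = tau_scale t *
    (if i == j then q * v (i, i) + w * \sum_(m < n | (m < i)%N) v (m, m)
     else v (j, i)) :> K.
Proof.
rewrite lext_coord; have [<-|ne] := eqVneq i j.
  rewrite (eq_bigr (fun p : I * I => (p == (i, i))%:R * (tau_scale t * (q * v (i, i))) +
     ((p.1 == p.2) && (p.1 < i)%N)%:R * (tau_scale t * (w * v (p.1, p.2))))) => [|[x y]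
       _].
    rewrite big_split sum_delta sum_pair mulrDr; congr (_ + _).
    rewrite mulr_sumr mulr_sumr [RHS]big_mkcond; apply: eq_bigr => x _.
    rewrite (bigD1 x) //= eqxx big1 ?addr0 => [|y].
      by case: ifP; rewrite ?mul1r ?mul0r.
    by rewrite eq_sym => /negPf ->; rewrite mul0r.
  rewrite ffunE xpair_eqE /=; have [->|ne] := eqVneq y x; last first.
    rewrite mul0r addr0 ffunE xpair_eqE.
    rewrite (_ : (i == y) && (i == x) = false); last first.
      by apply: contraNF ne => /andP[/eqP<- /eqP<-].
    rewrite (_ : (x == i) && (y == i) = false) ?mul0r; last first.
      by apply: contraNF ne => /andP[/eqP<- /eqP<-].
    by rewrite /GRing.scale /= !mulr0.
  rewrite !ffunE !xpair_eqE sum_ffunE !andbb [i == x]eq_sym.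
  have -> : \sum_(k < n | (x < k)%N) bvec K (k, k) (i, i) = (x < i)%:R.
    rewrite big_mkcond (bigD1 i) //= ffunE eqxx big1 ?addr0; first by case: ifP.
    move=> m; rewrite ffunE xpair_eqE andbb eq_sym => /negPf ->.
    by case: ifP.
  by rewrite /GRing.scale /tau_scale /=; have [->|_] := eqVneq x i; rewrite /=; ring.
rewrite (bigD1 (j, i)) //= (negPf ne) !ffunE eqxx big1 ?addr0 => [|[x y] nxy].
  by rewrite /GRing.scale /tau_scale /=; ring.
have b0 (m : I) : bvec K (m, m) (i, j) = 0.
  rewrite ffunE xpair_eqE (_ : _ && _ = false) //.
  by apply: contraNF ne => /andP[/eqP-> /eqP->].
rewrite ffunE; have [->|nyx] := eqVneq y x.
  rewrite !ffunE sum_ffunE big1 => [|m _]; last exact: b0.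
  have /= := b0 x; rewrite ffunE => ->.
  by rewrite /GRing.scale /tau_scale /=; ring.
rewrite ffunE [(i, j) == _]eq_sym xpair_eqE andbC -xpair_eqE (negPf nxy).
by rewrite /GRing.scale /tau_scale /=; ring.
Qed.

Definition to_T4 (u : MM) : T4 := [ffun p => ent u p.1.1 p.2.1 p.1.2 p.2.2].

Lemma VWVW_ent (v : T4) j i l k : ent (VWVW_to_MM K n v) j i l k = v ((j, i), (l, k)).
Proof.
rewrite lextE ent_sum (bigD1 (j, i, (l, k))) //= big1 ?addr0.
  by rewrite entZ ent_tens !mxE !eqxx !mulr1.
move=> [[j' i'] [l' k']] ne; rewrite entZ ent_tens !mxE -!natrM !mulnb.
rewrite (_ : _ && _ = false) ?mulr0 //; apply: contraNF ne.
by move=> /andP[/andP[/eqP-> /eqP->] /andP[/eqP-> /eqP->]].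
Qed.

Lemma lker_VWVW : lker (VWVW_to_MM K n) == 0%VS.
Proof.
apply/lker0P=> u v Euv; apply/ffunP=> -[[j i] [l k]].
by rewrite -!VWVW_ent Euv.
Qed.

(** On the diagonal coefficients the map is triangular with nonzero diagonal entries, since the
    value at [i] involves only m <= i; elsewhere it is a rescaled exchange. Hence [tau_VW^-1] in
    [tau_RE] is a true inverse. *)
Lemma lker_tau_VW : lker (tau_VW n t) == 0%VS.
Proof.
have Q0 := q_neq0 n t0; have R0 := tau_scale_neq0 t0.
apply/lker0P=> u v Euv; apply/ffunP=> -[j i].
have E x y : _ := congr1 (fun f : T2 => f (x, y) : K) Euv.
have [->|ne] := eqVneq j i; last first.
  by move: (E i j); rewrite !tau_VW_coord eq_sym (negPf ne) => /(mulfI R0).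
elim/ltn_ind: {i}(i : nat) {-2}i (erefl (i : nat)) => N IH i Ei.
move: (E i i); rewrite !tau_VW_coord eqxx => /(mulfI R0).
rewrite (eq_bigr (fun m => v (m, m))); first by move/addIr/(mulfI Q0).
by move=> m lt_mi; apply: (IH m) => //; rewrite -Ei.
Qed.

Lemma Theta_VWVW u :
  Theta t u = VWVW_to_MM K n (mid_lfun (tau_VW n t) (to_T4 u)).
Proof.
apply/entP=> j i l k; rewrite VWVW_ent mid_lfun_coord tau_VW_coord ent_Theta !ffunE /=.
by congr (_ * _); case: eqP => // _; congr (_ + _ * _); apply: eq_bigr => m _;
  rewrite !ffunE.
Qed.

Lemma Theta_surj (T : MM) : exists u, T = Theta t u.
Proof.
exists (of_ent (fun j i l k =>
  ((tau_VW n t)^-1)%VF [ffun p => ent T j p.1 p.2 k] (l, i))).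
apply/entP=> j i l k; rewrite Theta_VWVW VWVW_ent mid_lfun_coord.
rewrite (_ : slice _ _ _ = ((tau_VW n t)^-1)%VF [ffun p => ent T j p.1 p.2 k]).
  by rewrite lker0_lfunVK ?lker_tau_VW // ffunE.
by apply/ffunP=> -[x y]; rewrite !ffunE /= of_entK.
Qed.

Lemma to_T4_inj : injective to_T4.
Proof.
move=> u v Euv; apply/entP=> j i l k.
by have := congr1 (fun f : T4 => f ((j, l), (i, k))) Euv; rewrite !ffunE.
Qed.

Lemma Theta_inj : injective (@Theta K n t).
Proof.
move=> u v; rewrite !Theta_VWVW => /(lker0P lker_VWVW) Euv; apply: to_T4_inj.
by rewrite -(mid_lfunK (to_T4 u) lker_tau_VW) Euv mid_lfunK ?lker_tau_VW.
Qed.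

(** Together with [Theta_surj] this reduces every question about [tau_RE] to the flips of the V legs
    and of the V* legs. *)
Lemma tau_RE_Theta u : tau_RE n t (Theta t u) = Theta t (opP t (opQ t u)).
Proof.
rewrite /tau_RE !comp_lfunE Theta_VWVW lker0_lfunK ?lker_VWVW //.
rewrite mid_lfunK ?lker_tau_VW // Theta_VWVW; congr (VWVW_to_MM K n (mid_lfun _ _)).
apply/ffunP=> -[[j l] [i k]]; rewrite tens_lfun_coord ffunE /= of_entK.
rewrite lext_flip /flip2 !ffunE !of_entK /flip2 !lext_flip /flip2 !ffunE //=.
Qed.

End TauCoordinates.

(** * Killed vectors *)

(* [Z j l i k] says that the coefficient of e_j (x) e_l (x) f^i (x) f^k vanishes;
   e and e' tell whether the tensor is symmetric (true) or antisymmetric in the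
   V and in the V* legs. The hypotheses Zleft, Zright and Zboth are the equations
   X_p^- u = 0, in which by symmetry each pair of legs contributes one term. *)
Section ZeroPropagation.
Local Open Scope nat_scope.
Variables (n : nat) (e e' : bool) (Z : nat -> nat -> nat -> nat -> Prop).
Hypothesis n3 : 2 < n.
Hypothesis ZC : forall j l i k, Z j l i k -> Z l j i k.
Hypothesis ZC' : forall j l i k, Z j l i k -> Z j l k i.
Hypothesis Zdiag : forall j i k, ~~ e -> Z j j i k.
Hypothesis Zdiag' : forall j l i, ~~ e' -> Z j l i i.
Hypothesis Zout : forall j l i k, n <= i -> Z j l i k.
Hypothesis Zleft : forall p l i k, p.+1 < n -> l <> p \/ e ->
  i <> p.+1 -> k <> p.+1 -> Z p.+1 l i k.
Hypothesis Zright : forall p j l k, p.+1 < n -> j <> p -> l <> p ->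
  k <> p.+1 \/ e' -> Z j l p k.
Hypothesis Zboth : forall p l k, p.+1 < n -> l <> p \/ e ->
  k <> p.+1 \/ e' -> Z p.+1 l p.+1 k <-> Z p l p k.

(** [Zleft] leaves out the covector index p+1. This index is supplied by [Zboth] in the third place
    and by [ZC'] in the fourth. *)
Lemma Z_step p l : p.+1 < n -> l <> p \/ e ->
  (forall i k, Z p l i k) -> forall i k, Z p.+1 l i k.
Proof.
move=> pn lp Zp.
have main k : Z p.+1 l p.+1 k.
  have [/orP h|/norP[/negPn/eqP -> e'0]] := boolP ((k != p.+1) || e'); last exact: Zdiag'.
  by apply/Zboth => //; case: h => [/eqP|]; [left|right].
move=> i k; have [->|/eqP ni] := eqVneq i p.+1; first exact: main.
have [->|/eqP nk] := eqVneq k p.+1; first exact/ZC'/main.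
exact: Zleft.
Qed.

(** The boolean [~~ e] is read as a number: the smallest pair of V legs is (0, 0) in the symmetric
    case and (0, 1) in the antisymmetric one. Every other pair is reached by raising one index, by
    induction on the sum of the indices. *)
Lemma Z_descend : (forall i k, Z 0 (~~ e) i k) ->
  forall j l i k, j < n -> l < n -> Z j l i k.
Proof.
move=> Z0.
suff H m : forall j l, j <= l -> j + l <= m -> l < n -> forall i k, Z j l i k.
  move=> j l i k jn ln; case: (leqP j l) => jl; first exact: (H (j + l)).
  exact: ZC (H _ _ _ (ltnW jl) (leqnn _) jn _ _).
elim: m => [|m IH] j l jl jlm ln i k.
  move: jlm; rewrite leqn0 addn_eq0 => /andP[/eqP-> /eqP->].
  by case: (e) Z0 (@Zdiag) => /= [Z0 _|_ Zd]; [apply: Z0|apply: Zd].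
have [eq_jl|/eqP ne_jl] := eqVneq j l.
  subst l; have [e1|e0] := boolP e; last exact: Zdiag.
  case: j jl jlm ln => [_ _ _|p _ jlm ln]; first by move: (Z0 i k); rewrite e1.
  by apply: Z_step => [//||i' k']; [right|apply/IH; lia].
case: l jl jlm ln ne_jl => [|p] jl jlm ln ne_jl; first by lia.
have [jp|/eqP njp] := eqVneq j p; last first.
  by apply/ZC/Z_step => [//||i' k']; [left|apply/ZC/IH; lia].
subst j; have [e1|e0] := boolP e.
  by apply/ZC/Z_step => [//||i' k']; [right|apply/IH; lia].
(* For antisymmetric neighbours (p, p+1), raising the second index from (p, p) is excluded by the
   hypothesis of [Z_step], so the first index is raised instead; only (0, 1) cannot be reached in
   this way. *)
case: p ln jl jlm {ne_jl} => [|p] ln jl jlm.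
  by move: (Z0 i k); rewrite e0.
by apply: Z_step => [||i' k']; [lia|left; lia|apply/IH; lia].
Qed.

(** For the V legs (0, 0), [Zright] applies at every covector index except the first and the last.
    With antisymmetric V* legs it also fails at the smaller index of two neighbours; these are
    handled at the larger index unless that index is the last one. *)
Lemma Z_sym : e -> Z 0 0 0 n.-1 ->
    (if e' then Z 0 0 0 0 /\ Z 0 0 n.-1 n.-1 else Z 0 0 n.-2 n.-1) ->
  forall j l i k, j < n -> l < n -> Z j l i k.
Proof.
move=> e1 Z0N Zs; apply: Z_descend; rewrite e1 /=.
have [e1'|e0'] := boolP e'.
  rewrite e1' in Zs; case: Zs => Z00 ZNN.
  have mid i k : 0 < i -> i < n.-1 -> Z 0 0 i k.
    by move=> i0 iN; apply: Zright; [lia|lia|lia|right].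
  move=> i k; case: (ltnP i n) => [ltin|]; last exact: Zout.
  case: (ltnP k n) => [ltkn|lekn]; last exact/ZC'/Zout.
  have [iI|iE] : (0 < i /\ i < n.-1) \/ (i = 0 \/ i = n.-1) by lia.
    by case: iI => *; apply: mid.
  have [kI|kE] : (0 < k /\ k < n.-1) \/ (k = 0 \/ k = n.-1) by lia.
    by case: kI => *; apply/ZC'/mid.
  by case: iE kE => -> [] -> //; apply: ZC'.
rewrite (negPf e0') in Zs => i k.
suff H i' k' : i' < k' -> Z 0 0 i' k'.
  by case: (ltngtP i k) => [/H|/H/ZC'|->] //; apply: Zdiag'.
move=> lt_ik; case: (ltnP k' n) => [ltkn|lekn]; last exact/ZC'/Zout.
case: (ltnP k' n.-1) => kN.
  by apply/ZC'/Zright; [lia|lia|lia|left; lia].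
have -> : k' = n.-1 by lia.
have [->//|i0] := posnP i'.
have [->//|/eqP ne] := eqVneq i' n.-2.
by apply/Zright; [lia|lia|lia|left; lia].
Qed.

(** For the V legs (0, 1), [Zright] leaves the covector indices 0, 1 and n-1. Of the pairs formed
    from them, and the last pair of neighbours when the V* legs are antisymmetric, [Zboth] removes
    those that are not seeds. *)
Lemma Z_alt : ~~ e -> Z 0 1 1 n.-1 ->
    (if e' then Z 0 1 n.-1 n.-1 else Z 0 1 0 1 /\ Z 0 1 n.-2 n.-1) ->
  forall j l i k, j < n -> l < n -> Z j l i k.
Proof.
move=> e0 Z1N Zs; apply: Z_descend; rewrite e0 /=.
(* [Z 1 1 1 k] holds by antisymmetry, and [Zboth] with p = 0 carries it to [Z 0 1 0 k]. *)
have zero k : k <> 1 \/ e' -> Z 0 1 0 k.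
  move=> k1; have n1 : 1 < n by lia.
  have l0 : 1 <> 0 \/ e by left.
  by apply/(Zboth n1 l0 k1)/Zdiag.
have [e1'|e0'] := boolP e'.
  rewrite e1' in Zs.
  have mid i k : 1 < i -> i < n.-1 -> Z 0 1 i k.
    by move=> i0 iN; apply: Zright; [lia|lia|lia|right].
  have Z11 : Z 0 1 1 1.
    have l0 : 0 <> 1 \/ e by left.
    have k1 : 1 <> 2 \/ e' by right.
    apply/ZC/(Zboth n3 l0 k1).
    by apply/ZC'/Zright; [lia|lia|lia|right].
  move=> i k; case: (ltnP i n) => [ltin|]; last exact: Zout.
  case: (ltnP k n) => [ltkn|lekn]; last exact/ZC'/Zout.
  have [i0|iI] := posnP i; first by rewrite i0; apply: zero; right.
  have [k0|kI] := posnP k; first by rewrite k0; apply/ZC'/zero; right.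
  have [[*]|iE] : (1 < i /\ i < n.-1) \/ (i = 1 \/ i = n.-1) by lia.
    exact: mid.
  have [[*]|kE] : (1 < k /\ k < n.-1) \/ (k = 1 \/ k = n.-1) by lia.
    exact/ZC'/mid.
  by case: iE kE => -> [] -> //; apply: ZC'.
rewrite (negPf e0') in Zs => i k; case: Zs => Z01 ZNN.
suff H i' k' : i' < k' -> Z 0 1 i' k'.
  by case: (ltngtP i k) => [/H|/H/ZC'|->] //; apply: Zdiag'.
move=> lt_ik; case: (ltnP k' n) => [ltkn|lekn]; last exact/ZC'/Zout.
have [k1|/eqP k1] := eqVneq k' 1.
  by have -> : i' = 0 by [lia]; rewrite k1.
have [->|i0] := posnP i'; first by apply: zero; left.
case: (ltnP k' n.-1) => kN.
  by apply/ZC'/Zright; [lia|lia|lia|left; lia].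
have -> : k' = n.-1 by lia.
have [->//|/eqP i1] := eqVneq i' 1.
have [->//|/eqP ne] := eqVneq i' n.-2.
by apply/Zright; [lia|lia|lia|left; lia].
Qed.

End ZeroPropagation.

(** If both indices are [d], the symmetry relation merges the two terms into one multiple of
    [v c d]. The factor is nonzero because of 1 + h(d)^4, which is 1 + q^2 in the applications. *)
Lemma step2_eq0 (K : fieldType) (I : eqType) (d c : I) (h : I -> K) v y :
    (forall x, h x != 0) -> 1 + h d ^+ 4 != 0 ->
    y != d \/ v c d = h d ^+ 2 * v d c ->
  step2 d c h v d y = 0 <-> v c y = 0.
Proof.
move=> h0 hd Hy; rewrite /step2 eqxx mul1r.
have [Ey|ne] := eqVneq y d; last first.
  rewrite !mul0r addr0; split=> [/eqP|->]; last by rewrite mulr0.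
  by rewrite mulf_eq0 (negPf (h0 _)) => /eqP.
case: Hy => [/eqP //|Hv]; rewrite Ey mul1r.
have -> : h d * v c d + (h d)^-1 * v d c = (1 + h d ^+ 4) / h d ^+ 3 * v c d.
  by rewrite Hv; field; rewrite h0.
split=> [/eqP|->]; last by rewrite mulr0.
rewrite !mulf_eq0 invr_eq0 expf_eq0 /= (negPf (h0 _)) (negPf hd) /=.
by move/eqP.
Qed.

Section Seeds.
Variables (K : fieldType) (n : nat) (t : K).
Hypothesis t0 : t != 0.
Hypothesis q2 : 1 + qq n t ^+ 2 != 0.
Hypothesis two0 : 2 != 0 :> K.
Hypothesis n3 : (2 < n)%N.
Local Notation MM := 'M[K]_(n * n).
Local Notation q := (qq n t).
Local Notation w := (omega n t).
Local Notation I := 'I_n.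
Local Notation s0 := ((1 - q ^+ 2) / (1 + q ^+ 2)).
Local Notation c0 := (2 * q / (1 + q ^+ 2)).

Definition tau_sign (e : bool) : K := if e then 1 else -1.

Lemma flip2_eigen (sig : I -> I -> K) (v : I -> I -> K) e x y :
    flip2 sig s0 c0 v x y = tau_sign e * v x y -> x != y -> sig x y = -1 ->
  if e then v x y = q * v y x else q * v x y = - v y x.
Proof.
have Q0 : q != 0 := q_neq0 n t0.
rewrite /flip2 => + /negPf nxy sxy; rewrite nxy sxy.
set A := v x y; set B := v y x => E.
have E' : -1 * (1 - q ^+ 2) * A + 2 * q * B = (1 + q ^+ 2) * (tau_sign e * A).
  by rewrite -E; field.
have h : forall X Y : K, (2 * q) * X = 2 * q * Y -> X = Y.
  by move=> X Y; apply: mulfI; rewrite mulf_neq0.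
case: (e) E' => /= E'.
  by apply: (mulfI two0); apply/eqP; rewrite -subr_eq0; apply/eqP; move/eqP: E';
    rewrite -subr_eq0 => /eqP E'; rewrite -[RHS]oppr0 -E'; ring.
by apply: h; apply/eqP; rewrite -subr_eq0; apply/eqP; move/eqP: E';
  rewrite -subr_eq0 => /eqP E'; rewrite -E'; ring.
Qed.

Lemma flip2_diag (sig : I -> I -> K) (v : I -> I -> K) e x :
    flip2 sig s0 c0 v x x = tau_sign e * v x x -> ~~ e -> v x x = 0.
Proof.
rewrite /flip2 eqxx => + e0; rewrite (negPf e0) /= mulN1r => E.
by apply/eqP; move/eqP: E;
  rewrite -subr_eq0 opprK -mulr2n -mulr_natl mulf_eq0 (negPf two0).
Qed.

Section Eigen.
Variables (e e' : bool) (u : MM).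
Hypothesis uX : forall p, opX t false p u = 0.
Hypothesis uP : opP t u = tau_sign e *: u.
Hypothesis uQ : opQ t u = tau_sign e' *: u.

(** Natural numbers as indices keep the propagation argument free of ordinals. Outside the range the
    condition is vacuous, as [Zout] requires. *)
Let Z (j l i k : nat) := forall j' l' i' k' : I,
  j' = j :> nat -> l' = l :> nat -> i' = i :> nat -> k' = k :> nat ->
  ent u j' i' l' k' = 0.

Lemma eigenP (j i l k : I) : (j < l)%N ->
  if e then ent u l i j k = q * ent u j i l k
  else q * ent u l i j k = - ent u j i l k.
Proof.
move=> jl; have := congr1 (fun T => ent T l i j k) uP.
rewrite of_entK entZ => /flip2_eigen; apply.
  by rewrite -val_eqE /= gtn_eqF.
by rewrite /sgn_lt ltnNge (ltnW jl).
Qed.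

Lemma eigenQ (j i l k : I) : (i < k)%N ->
  if e' then ent u j i l k = q * ent u j k l i
  else q * ent u j i l k = - ent u j k l i.
Proof.
move=> ik; have := congr1 (fun T => ent T j i l k) uQ.
rewrite of_entK entZ => /(@flip2_eigen (fun a b : I => sgn_lt K b a)); apply.
  by rewrite -val_eqE /= ltn_eqF.
by rewrite /sgn_lt ltnNge (ltnW ik).
Qed.

Lemma eigenPC j i l k : ent u j i l k = 0 -> ent u l i j k = 0.
Proof.
have Q0 : q != 0 := q_neq0 n t0.
case: (ltngtP j l) => [jl|lj|/val_inj-> //] u0.
  have := eigenP i k jl; rewrite u0; case: (e); first by rewrite mulr0.
  by rewrite oppr0 => /eqP; rewrite mulf_eq0 (negPf Q0) => /eqP.
have := eigenP i k lj; rewrite u0; case: (e) => [/esym|].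
  by move=> /eqP; rewrite mulf_eq0 (negPf Q0) => /eqP.
by rewrite mulr0 => /esym/eqP; rewrite oppr_eq0 => /eqP.
Qed.

Lemma eigenQC j i l k : ent u j i l k = 0 -> ent u j k l i = 0.
Proof.
have Q0 : q != 0 := q_neq0 n t0.
case: (ltngtP i k) => [ik|ki|/val_inj-> //] u0.
  have := eigenQ j l ik; rewrite u0; case: (e') => [/esym|].
    by move=> /eqP; rewrite mulf_eq0 (negPf Q0) => /eqP.
  by rewrite mulr0 => /esym/eqP; rewrite oppr_eq0 => /eqP.
have := eigenQ j l ki; rewrite u0; case: (e'); first by rewrite mulr0.
by rewrite oppr0 => /eqP; rewrite mulf_eq0 (negPf Q0) => /eqP.
Qed.

Lemma lowering (p : 'I_n.-1) j i l k :
  - q * (kappa t false p i)^-1 * (kappa t false p k)^-1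
    * step2 (lo p) (hi p) (kappa t false p) (fun j l => ent u j i l k) j l
  + (kappa t false p j)^-1 * (kappa t false p l)^-1
    * step2 (hi p) (lo p) (fun x => (kappa t false p x)^-1)
        (fun i k => ent u j i l k) i k = 0.
Proof.
rewrite -(ent0 K j i l k) -(uX p) of_entK /src /=.
by rewrite (@qh2 _ n t).
Qed.

Lemma step_e_eq0 (p : 'I_n.-1) i l k : l != lo p \/ e ->
  step2 (lo p) (hi p) (kappa t false p) (fun j l => ent u j i l k) (lo p) l = 0
  <-> ent u (hi p) i l k = 0.
Proof.
move=> lp; have kl : kappa t false p (lo p) = qhalf n t by exact: (kappa_tgtE t false p).
apply: step2_eq0 => [x||].
- exact: kappa_neq0.
- by rewrite kl (_ : qhalf n t ^+ 4 = q ^+ 2) // -qh2 -exprM.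
- case: lp => [|e1]; [by left|right]; rewrite kl qh2.
  by have := eigenP i k (ltnSn p : (lo p < hi p)%N); rewrite e1.
Qed.

Lemma step_f_eq0 (p : 'I_n.-1) j l k : k != hi p \/ e' ->
  step2 (hi p) (lo p) (fun x => (kappa t false p x)^-1) (fun i k => ent u j i l k) (hi
    p) k = 0
  <-> ent u j (lo p) l k = 0.
Proof.
move=> lp; have kl : (kappa t false p (hi p))^-1 = qhalf n t.
  by rewrite (kappa_srcE t false p) invrK.
apply: step2_eq0 => [x||].
- by rewrite invr_eq0 kappa_neq0.
- by rewrite kl (_ : qhalf n t ^+ 4 = q ^+ 2) // -qh2 -exprM.
- case: lp => [|e1]; [by left|right]; rewrite kl qh2.
  by have := eigenQ j l (ltnSn p : (lo p < hi p)%N); rewrite e1.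
Qed.

Lemma step2_out (a b : I) g (v : I -> I -> K) x y :
  x != a -> y != a -> step2 a b g v x y = 0.
Proof. by move=> /negPf tgt /negPf ya; rewrite /step2 tgt ya !mul0r addr0. Qed.

(** The hypotheses of the propagation lemmas are read off from single coefficients of X_p^- u = 0:
    with [lo p] on a V leg and no [hi p] on the V* legs only the V part survives ([Zleft]), with
    [hi p] on a V* leg and no [lo p] on the V legs only the V* part ([Zright]), and with both
    present the two parts determine each other ([Zboth]). *)
Lemma eigen_kernel_eq0 :
  (if e then Z 0 0 0 n.-1 /\ (if e' then Z 0 0 0 0 /\ Z 0 0 n.-1 n.-1 else Z 0 0 n.-2
    n.-1)
   else Z 0 1 1 n.-1 /\ (if e' then Z 0 1 n.-1 n.-1 else Z 0 1 0 1 /\ Z 0 1 n.-2 n.-1)) ->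
  u = 0.
Proof.
have Q0 : q != 0 := q_neq0 n t0.
have ZC j l i k : Z j l i k -> Z l j i k.
  by move=> z j' l' i' k' *; apply/eigenPC/z.
have ZC' j l i k : Z j l i k -> Z j l k i.
  by move=> z j' l' i' k' *; apply/eigenQC/z.
have Zd j i k : ~~ e -> Z j j i k.
  move=> e0 j' l' i' k' Ej El _ _; have -> : l' = j' by apply: val_inj; rewrite /= Ej El.
  have := congr1 (fun T => ent T j' i' j' k') uP; rewrite of_entK entZ.
  by move=> /flip2_diag -> //.
have Zd' j l i : ~~ e' -> Z j l i i.
  move=> e0 j' l' i' k' _ _ Ei Ek; have -> : k' = i' by apply: val_inj; rewrite /= Ei Ek.
  have := congr1 (fun T => ent T j' i' l' i') uQ; rewrite of_entK entZ.
  by move=> /(@flip2_diag (fun a b : I => sgn_lt K b a)) -> //.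
have Zo j l i k : (n <= i)%N -> Z j l i k.
  by move=> ni j' l' i' k' _ _ Ei; have := ltn_ord i'; rewrite Ei ltnNge ni.
have [lop hip] : (forall p (pn : (p < n.-1)%N) (x : I), x = p :> nat -> x = lo (Ordinal
  pn)) /\
   (forall p (pn : (p < n.-1)%N) (x : I), x = p.+1 :> nat -> x = hi (Ordinal pn)).
  by split=> p pn x xp; apply: val_inj.
have pN p : (p.+1 < n)%N -> (p < n.-1)%N by lia.
have gi (p : 'I_n.-1) x : (kappa t false p x)^-1 != 0 :> K by rewrite invr_eq0 kappa_neq0.
have Zl p l i k : (p.+1 < n)%N -> l <> p \/ e ->
  i <> p.+1 -> k <> p.+1 -> Z p.+1 l i k.
  move=> /pN pn lp ip kp j' l' i' k' /(hip _ pn) -> El Ei Ek.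
  have := lowering (Ordinal pn) (lo (Ordinal pn)) i' l' k'.
  rewrite (@step2_out (hi _)) ?mulr0 ?addr0; last 2 first.
  - by rewrite -val_eqE /= Ei; apply/eqP.
  - by rewrite -val_eqE /= Ek; apply/eqP.
  move/eqP; rewrite !mulf_eq0 oppr_eq0 (negPf Q0) !(negPf (gi _ _)) /= =>
    /eqP/step_e_eq0; apply.
  by case: lp => [/eqP lp|]; [left; rewrite -val_eqE /= El|right].
have Zr p j l k : (p.+1 < n)%N -> j <> p -> l <> p ->
  k <> p.+1 \/ e' -> Z j l p k.
  move=> /pN pn jp lp kp j' l' i' k' Ej El /(lop _ pn) -> Ek.
  have := lowering (Ordinal pn) j' (hi (Ordinal pn)) l' k'.
  rewrite (@step2_out (lo _)) ?mulr0 ?add0r; last 2 first.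
  - by rewrite -val_eqE /= Ej; apply/eqP.
  - by rewrite -val_eqE /= El; apply/eqP.
  move/eqP; rewrite !mulf_eq0 !(negPf (gi _ _)) /= => /eqP/step_f_eq0; apply.
  by case: kp => [/eqP kp|]; [left; rewrite -val_eqE /= Ek|right].
have Zb p l k : (p.+1 < n)%N -> l <> p \/ e ->
  k <> p.+1 \/ e' -> Z p.+1 l p.+1 k <-> Z p l p k.
  move=> /pN pn lp kp; split=> z j' l' i' k'.
    move=> /(lop _ pn) -> El /(lop _ pn) -> Ek.
    have lp' : l' != lo (Ordinal pn) \/ e.
      by case: lp => [/eqP lp|]; [left; rewrite -val_eqE /= El|right].
    have kp' : k' != hi (Ordinal pn) \/ e'.
      by case: kp => [/eqP kp|]; [left; rewrite -val_eqE /= Ek|right].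
    have := lowering (Ordinal pn) (lo (Ordinal pn)) (hi (Ordinal pn)) l' k'.
    rewrite (proj2 (step_e_eq0 _ _ lp')); last exact: z.
    rewrite mulr0 add0r => /eqP; rewrite !mulf_eq0 !(negPf (gi _ _)) /= => /eqP.
    by move/(proj1 (step_f_eq0 _ _ kp')).
  move=> /(hip _ pn) -> El /(hip _ pn) -> Ek.
  have lp' : l' != lo (Ordinal pn) \/ e.
    by case: lp => [/eqP lp|]; [left; rewrite -val_eqE /= El|right].
  have kp' : k' != hi (Ordinal pn) \/ e'.
    by case: kp => [/eqP kp|]; [left; rewrite -val_eqE /= Ek|right].
  have := lowering (Ordinal pn) (lo (Ordinal pn)) (hi (Ordinal pn)) l' k'.
  rewrite (proj2 (step_f_eq0 _ _ kp')); last exact: z.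
  rewrite mulr0 addr0 => /eqP.
  rewrite !mulf_eq0 oppr_eq0 (negPf Q0) !(negPf (gi _ _)) /= => /eqP.
  by move/(proj1 (step_e_eq0 _ _ lp')).
move=> seeds; apply/entP=> j i l k; rewrite ent0.
suff : Z j l i k by apply.
case: (boolP e) seeds => e1 [z1 z2].
  exact: (@Z_sym n e e' Z).
exact: (@Z_alt n e e' Z).
Qed.

End Eigen.
End Seeds.

Section Linearity.
Variables (K : fieldType) (n : nat) (t : K).
Local Notation MM := 'M[K]_(n * n).

Fact opP_is_linear : linear (@opP K n t).
Proof.
move=> c u v; apply/entP=> j i l k; rewrite entD entZ !of_entK /flip2 !entD !entZ.
by case: eqP => _; ring.
Qed.
HB.instance Definition _ := GRing.isLinear.Build K MM MM *:%R (@opP K n t) opP_is_linear.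

Fact opQ_is_linear : linear (@opQ K n t).
Proof.
move=> c u v; apply/entP=> j i l k; rewrite entD entZ !of_entK /flip2 !entD !entZ.
by case: eqP => _; ring.
Qed.
HB.instance Definition _ := GRing.isLinear.Build K MM MM *:%R (@opQ K n t) opQ_is_linear.

Fact opX_is_linear s p : linear (@opX K n t s p).
Proof.
move=> c u v; apply/entP=> j i l k; rewrite entD entZ !of_entK /step2 !entD !entZ.
by ring.
Qed.
HB.instance Definition _ s p :=
  GRing.isLinear.Build K MM MM *:%R (@opX K n t s p) (opX_is_linear s p).

Fact Theta_is_linear : linear (@Theta K n t).
Proof.
move=> c u v; apply/entP=> j i l k; rewrite entD entZ !ent_Theta !entD !entZ.
under eq_bigr => m _ do rewrite entD entZ.
by rewrite big_split /= -mulr_sumr; case: eqP => _; ring.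
Qed.
HB.instance Definition _ := GRing.isLinear.Build K MM MM *:%R (@Theta K n t)
  Theta_is_linear.

HB.instance Definition _ x :=
  GRing.isLinear.Build K MM MM *:%R (@act K n t x) (act_linear t x).

End Linearity.

(** * Seed coordinates and the eigenspaces of tau_RE *)

Section Corners.
Variable n : nat.
Hypothesis n3 : (2 < n)%N.

Fact ord_1_subproof : (0 < n)%N. Proof. by lia. Qed.
Fact ord_2_subproof : (1 < n)%N. Proof. by lia. Qed.
Fact ord_prev_subproof : (n.-2 < n)%N. Proof. by lia. Qed.
Fact ord_last_subproof : (n.-1 < n)%N. Proof. by lia. Qed.
Definition ord_1 : 'I_n := Ordinal ord_1_subproof.
Definition ord_2 : 'I_n := Ordinal ord_2_subproof.
Definition ord_prev : 'I_n := Ordinal ord_prev_subproof.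
Definition ord_last : 'I_n := Ordinal ord_last_subproof.

(* For the eigenvalue 1 (h = true) or -1 of tau_RE, the pairs (i, k) for which the
   coefficients of e_1 (x) e_1 (x) f^i (x) f^k, respectively of the antisymmetrized
   e_1 (x) e_2 (x) f^i (x) f^k, determine a killed vector. For n = 3 the pairs
   (n - 1, n) and (2, n) coincide. *)
Definition sym_seeds (h : bool) : seq ('I_n * 'I_n) :=
  if h then [:: (ord_1, ord_last); (ord_1, ord_1); (ord_last, ord_last)]
  else [:: (ord_1, ord_last); (ord_prev, ord_last)].
Definition alt_seeds (h : bool) : seq ('I_n * 'I_n) :=
  if h then [:: (ord_2, ord_last); (ord_1, ord_2)]
             ++ (if (3 < n)%N then [:: (ord_prev, ord_last)] else [::])
  else [:: (ord_2, ord_last); (ord_last, ord_last)].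

Lemma sym_seeds_leq h x : x \in sym_seeds h -> (x.1 <= x.2)%N.
Proof. by case: h; rewrite !inE; [case/or3P|case/orP] => /eqP-> /=; lia. Qed.
Lemma alt_seeds_leq h x : x \in alt_seeds h -> (x.1 <= x.2)%N.
Proof.
case: h; rewrite /alt_seeds; last by rewrite !inE => /orP[] /eqP-> /=; lia.
by case: ifP => _; rewrite !inE; [case/or3P|case/orP] => /eqP-> /=; lia.
Qed.

End Corners.

Section KernelOfTau.
Variables (K : fieldType) (n : nat) (t : K).
Hypothesis t0 : t != 0.
Hypothesis q2 : 1 + qq n t ^+ 2 != 0.
Hypothesis two0 : 2 != 0 :> K.
Hypothesis n3 : (2 < n)%N.
Local Notation MM := 'M[K]_(n * n).
Local Notation q := (qq n t).
Local Notation w := (omega n t).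
Local Notation I := 'I_n.
Local Notation s0 := ((1 - q ^+ 2) / (1 + q ^+ 2)).
Local Notation c0 := (2 * q / (1 + q ^+ 2)).
Local Notation sgF := (fun a b : I => sgn_lt K b a).

Local Notation i0 := (ord_1 n3).
Local Notation i1 := (ord_2 n3).
Local Notation iM := (ord_prev n3).
Local Notation iN := (ord_last n3).

(** The mixed terms cancel because [sig] changes sign under exchange, and the squares of [s0] and
    [c0] add up to 1. *)
Lemma flip2K (sig : I -> I -> K) (v v' : I -> I -> K) x y :
    (x != y -> sig x y = - sig y x) -> (sig x y) ^+ 2 = 1 ->
    (forall x y, v' x y = flip2 sig s0 c0 v x y) ->
  flip2 sig s0 c0 v' x y = v x y.
Proof.
move=> sN s1 v'E; rewrite /flip2 !v'E /flip2 [y == x]eq_sym.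
case: eqP sN => [->//|_] /(_ isT) sN.
have -> : sig y x = - sig x y by rewrite sN opprK.
transitivity (sig x y ^+ 2 * s0 ^+ 2 * v x y + c0 ^+ 2 * v x y); first by ring.
by rewrite s1; field.
Qed.

Lemma sgn_lt_anti (x y : I) : x != y -> sgn_lt K x y = - sgn_lt K y x.
Proof.
rewrite /sgn_lt -val_eqE /=.
by case: (ltngtP x y) => //= _ _; rewrite opprK.
Qed.
Lemma sgn_lt_sqr (x y : I) : sgn_lt K x y ^+ 2 = 1.
Proof. by rewrite /sgn_lt; case: ifP => _; rewrite ?sqrrN expr1n. Qed.

Lemma opPK (u : MM) : opP t (opP t u) = u.
Proof.
apply/entP=> j i l k; rewrite of_entK.
apply: (@flip2K (fun a b => sgn_lt K a b) (fun j l => ent u j i l k));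
  [exact: sgn_lt_anti|exact: sgn_lt_sqr|].
by move=> x y; rewrite of_entK.
Qed.

Lemma opQK (u : MM) : opQ t (opQ t u) = u.
Proof.
apply/entP=> j i l k; rewrite of_entK.
apply: (@flip2K (fun a b => sgn_lt K b a) (fun i k => ent u j i l k)).
- by rewrite eq_sym; apply: sgn_lt_anti.
- exact: sgn_lt_sqr.
- by move=> x y; rewrite of_entK.
Qed.

Lemma opPQ (u : MM) : opP t (opQ t u) = opQ t (opP t u).
Proof.
apply/entP=> j i l k; rewrite !of_entK /flip2 !of_entK /flip2.
by case: (j =P l) => _; case: (i =P k) => _; ring.
Qed.

Definition sym_coord (u : MM) (i k : I) : K := ent u i0 i i0 k.
(** Up to the factor [c0], the coefficient of the antisymmetric part [u - opP t u] at e_1 (x)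
    e_2. *)
Definition alt_coord (u : MM) (i k : I) : K := q * ent u i0 i i1 k - ent u i1 i i0 k.

(** The vectors [u + opP t u] and [u - opP t u] have the symmetry types (true, h) and (false, ~~ h),
    and their seeds are multiples of the given coordinates. Both vanish, and their sum is 2u. *)
Lemma seeds_eq0 h (u : MM) :
    (forall p, opX t false p u = 0) -> opP t (opQ t u) = tau_sign K h *: u ->
    (forall x, x \in sym_seeds n3 h -> sym_coord u x.1 x.2 = 0) ->
    (forall x, x \in alt_seeds n3 h -> alt_coord u x.1 x.2 = 0) ->
  u = 0.
Proof.
move=> uX uPQ uS uL.
have Q0 : q != 0 := q_neq0 n t0.
have uQ : opQ t u = tau_sign K h *: opP t u.
    by rewrite -[LHS]opPK uPQ linearZ /=.
have Zi (T : MM) (a b c d : I) : ent T a c b d = 0 -> forall j l i k : I,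
    j = a :> nat -> l = b :> nat -> i = c :> nat -> k = d :> nat -> ent T j i l k = 0.
  by move=> T0 j l i k /val_inj-> /val_inj-> /val_inj-> /val_inj->.
have yS i k : sym_coord u i k = 0 -> ent (u + opP t u) i0 i i0 k = 0.
  by move=> uik; rewrite entD of_entK /flip2 eqxx -/(sym_coord u i k) uik addr0.
have zL i k : alt_coord u i k = 0 -> ent (u - opP t u) i0 i i1 k = 0.
  move=> uik; rewrite entD entN of_entK /flip2 /sgn_lt /=.
  rewrite (_ : _ - _ = 2 * q / (1 + q ^+ 2) * alt_coord u i k);
    first by rewrite uik mulr0.
  by rewrite /alt_coord; field.
have y0 : u + opP t u = 0.
  apply: (eigen_kernel_eq0 t0 q2 two0 n3 (e := true) (e' := h)).
  - by move=> p; rewrite linearD /= uX -opP_X // uX linear0 /= addr0.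
  - by rewrite linearD /= opPK scale1r addrC.
  - by rewrite linearD /= uQ -opPQ uPQ scalerDr addrC.
  split; first by apply/(@Zi _ i0 i0 i0 iN)/yS/(uS (i0, iN)); rewrite /sym_seeds;
    case: (h); apply: mem_head.
  case: (h) uS => uS; last first.
    by apply/(@Zi _ i0 i0 iM iN)/yS/(uS (iM, iN)); rewrite !inE eqxx orbT.
  split; first by apply/(@Zi _ i0 i0 i0 i0)/yS/(uS (i0, i0)); rewrite !inE eqxx !orbT.
  by apply/(@Zi _ i0 i0 iN iN)/yS/(uS (iN, iN)); rewrite !inE eqxx !orbT.
have z0 : u - opP t u = 0.
  apply: (eigen_kernel_eq0 t0 q2 two0 n3 (e := false) (e' := ~~ h)).
  - by move=> p; rewrite linearB /= uX -opP_X // uX linear0 /= subr0.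
  - by rewrite linearB /= opPK scaleN1r opprB.
  - rewrite linearB /= uQ -opPQ uPQ -scalerBr -opprB scalerN -scaleNr.
    by congr (_ *: _); case: (h); rewrite /tau_sign ?opprK.
  split; first by apply/(@Zi _ i0 i1 i1 iN)/zL/(uL (i1, iN)); rewrite /alt_seeds;
    case: (h); apply: mem_head.
  case: (h) uL => uL /=; last first.
    by apply/(@Zi _ i0 i1 iN iN)/zL/(uL (iN, iN)); rewrite !inE eqxx orbT.
  split; first by apply/(@Zi _ i0 i1 i0 i1)/zL/(uL (i0, i1)); rewrite !inE eqxx !orbT.
  apply/(@Zi _ i0 i1 iM iN)/zL; case: (ltnP 3 n) uL => [n4|n4] uL.
    by apply: (uL (iM, iN)); rewrite /alt_seeds n4 !inE eqxx !orbT.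
  have -> : iM = i1 by apply: val_inj => /=; lia.
  by apply: (uL (i1, iN)); rewrite mem_head.
have : (2 : K) *: u = 0.
  rewrite scaler_nat mulr2n.
  have {1}-> : u = - opP t u by apply/eqP; rewrite -addr_eq0 y0.
  by rewrite addrC z0.
by move/eqP; rewrite scaler_eq0 (negPf two0) => /eqP.
Qed.

(* sym_coord u and alt_coord u, up to a factor, in terms of v = Theta u. *)
Definition sym_coord_RE (v : MM) (i k : I) : K :=
  (if i == i0 then q^-1 else 1) * ent v i0 i i0 k.
Definition alt_coord_RE (v : MM) (i k : I) : K :=
  (if i == i1 then ent v i0 i1 i1 k - w * q^-1 * ent v i0 i0 i0 k
   else q * ent v i0 i i1 k)
  - (if i == i0 then q^-1 else 1) * ent v i1 i i0 k.

Lemma sym_coord_RE_linear c u v i k : sym_coord_RE (c *: u + v) i k = c * sym_coord_RE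
  u i k + sym_coord_RE v i k.
Proof. by rewrite /sym_coord_RE entD entZ; ring. Qed.
Lemma alt_coord_RE_linear c u v i k : alt_coord_RE (c *: u + v) i k = c * alt_coord_RE
  u i k + alt_coord_RE v i k.
Proof. by rewrite /alt_coord_RE !entD !entZ; case: ifP => _; ring. Qed.

Lemma sum_lt_i0 (f : I -> K) : \sum_(m < n | (m < i0)%N) f m = 0.
Proof. by rewrite big1. Qed.
Lemma sum_lt_i1 (f : I -> K) : \sum_(m < n | (m < i1)%N) f m = f i0.
Proof.
by rewrite (bigD1 i0) //= big1 ?addr0 // => m /andP[m1]; rewrite -val_eqE /=; lia.
Qed.

Lemma i01 : (i0 == i1) = false. Proof. by []. Qed.
Lemma i10 : (i1 == i0) = false. Proof. by []. Qed.

Lemma sym_coord_RE_Theta u i k : sym_coord_RE (Theta t u) i k = tau_scale t * sym_coord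
  u i k.
Proof.
have Q0 : q != 0 := q_neq0 n t0.
rewrite /sym_coord_RE /sym_coord ent_Theta; have [->|_] := eqVneq i i0;
  last by rewrite mul1r.
by rewrite sum_lt_i0; field.
Qed.

(** The factors q^-1 and the term with [w] in [alt_coord_RE] invert [Theta] on the coefficients with
    i = l, where for l = 2 the partial sum has the single term m = 1. *)
Lemma alt_coord_RE_Theta u i k : alt_coord_RE (Theta t u) i k = tau_scale t * alt_coord
  u i k.
Proof.
have Q0 : q != 0 := q_neq0 n t0.
rewrite /alt_coord_RE /alt_coord !ent_Theta eqxx.
have [->|n1] := eqVneq i i1.
  by rewrite i10 ?eqxx sum_lt_i1 sum_lt_i0; field.
have [->|n0] := eqVneq i i0; last by ring.
by rewrite ?eqxx sum_lt_i0; field.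
Qed.

Definition killed (v : MM) := forall p, act t (UX false p) v = 0.

Lemma killed_Theta u : killed (Theta t u) -> forall p, opX t false p u = 0.
Proof.
move=> ku p; apply: (Theta_inj t0); rewrite -act_Theta // ku.
by rewrite linear0.
Qed.

Lemma killed_eq0 h v : killed v -> tau_RE n t v = tau_sign K h *: v ->
    (forall x, x \in sym_seeds n3 h -> sym_coord_RE v x.1 x.2 = 0) ->
    (forall x, x \in alt_seeds n3 h -> alt_coord_RE v x.1 x.2 = 0) ->
  v = 0.
Proof.
have [u ->] := Theta_surj t0 v => /killed_Theta ku.
rewrite tau_RE_Theta // => Eu vS vL.
rewrite (@seeds_eq0 h u) ?linear0 //.
- by apply: (Theta_inj t0); rewrite Eu linearZ.
- move=> x /vS; rewrite sym_coord_RE_Theta => /eqP.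
  by rewrite mulf_eq0 (negPf (tau_scale_neq0 t0)) => /eqP.
- move=> x /vL; rewrite alt_coord_RE_Theta => /eqP.
  by rewrite mulf_eq0 (negPf (tau_scale_neq0 t0)) => /eqP.
Qed.

(* For f = sym_coord_RE v this says that the part of v in the eigenspace of the other
   sign has coordinate 0 at (i, k). *)
Definition exchanged (b : bool) (f : I -> I -> K) (i k : I) : Prop :=
  if i == k then b \/ f i k = 0
  else if b then f i k = q * f k i else q * f i k = - f k i.

Lemma exchanged_flip2 b f (i k : I) : (i <= k)%N -> exchanged b f i k ->
  f i k - tau_sign K b * flip2 (fun a b : I => sgn_lt K b a) s0 c0 f i k = 0.
Proof.
rewrite /exchanged /flip2 leq_eqVlt (inj_eq val_inj) => lik.
have [->|ne] := eqVneq i k.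
  by case: b => [_|[//|->]] /=; rewrite ?mul1r ?mulr0 subrr.
rewrite (negPf ne) /= in lik.
rewrite /sgn_lt ltnNge (ltnW lik) /=; case: b => /= E.
  by rewrite E; field.
have -> : f k i = - (q * f i k) by rewrite E opprK.
by field.
Qed.

(** The difference of [u] and its signed image under both flips is a killed vector of the opposite
    eigenspace, so [seeds_eq0] applies to it. At the seeds [opP] acts as 1 on [sym_coord] and as -1
    on [alt_coord]; only the flip of the V* legs remains, and [exchanged] states its effect. *)
Lemma tau_criterion h v : killed v ->
    (forall x, x \in sym_seeds n3 (~~ h) -> exchanged h (sym_coord_RE v) x.1 x.2) ->
    (forall x, x \in alt_seeds n3 (~~ h) -> exchanged (~~ h) (alt_coord_RE v) x.1 x.2) ->
  tau_RE n t v = tau_sign K h *: v.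
Proof.
have [u ->] := Theta_surj t0 v => /killed_Theta ku vS vL.
rewrite tau_RE_Theta //.
have hh : tau_sign K h * tau_sign K h = 1 by case: (h);
  rewrite /tau_sign ?mulr1 // mulrNN mulr1.
suff /eqP : u - tau_sign K h *: opP t (opQ t u) = 0.
  rewrite subr_eq0 => /eqP {2}->; rewrite linearZ /= scalerA hh scale1r //.
have R0 := tau_scale_neq0 t0.
have ex b (f g : I -> I -> K) i k : (forall i k, f i k = tau_scale t * g i k) ->
   exchanged b f i k -> exchanged b g i k.
  move=> fg; rewrite /exchanged !fg; case: eqP => _.
    by case=> [|/eqP]; [left|rewrite mulf_eq0 (negPf R0) => /eqP; right].
  by case: b; rewrite mulrCA => E; apply: (mulfI R0); rewrite // mulrN.
apply: (@seeds_eq0 (~~ h)).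
- by move=> p; rewrite linearB linearZ /= -opP_X // -opQ_X // ku !linear0 ?scaler0
    ?subr0 ?addr0.
- rewrite [opQ t _]linearB /= [opP t _]linearB /= [opQ t (_ *: _)]linearZ /= [opP t (_
    *: _)]linearZ /=.
  rewrite -(opPQ (opQ t u)) opQK opPK scalerBr scalerA.
  have -> : tau_sign K (~~ h) = - tau_sign K h by case: (h); rewrite /tau_sign ?opprK.
  by rewrite mulNr hh !scaleNr scale1r opprK addrC.
- move=> x xS; rewrite -[RHS](exchanged_flip2 (sym_seeds_leq xS) (ex _ _ _ _ _
    (sym_coord_RE_Theta u) (vS x xS))).
  rewrite /sym_coord entD entN entZ of_entK /flip2 eqxx of_entK //.
- move=> x xL; rewrite -[RHS](exchanged_flip2 (alt_seeds_leq xL) (ex _ _ _ _ _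
    (alt_coord_RE_Theta u) (vL x xL))).
  have -> : tau_sign K (~~ h) = - tau_sign K h by case: (h); rewrite /tau_sign ?opprK.
  rewrite /alt_coord !entD !entN !entZ !of_entK /flip2 i01 i10 /sgn_lt /= !of_entK /flip2.
  by case: eqP => _; rewrite /sgn_lt /=; field.
Qed.

End KernelOfTau.

Lemma mem_leigenspace (K : fieldType) (V : vectType K) (f : 'End(V)) (a : K) v :
  v \in passmx.leigenspace f a <-> f v = a *: v.
Proof.
rewrite memv_ker add_lfunE opp_lfunE scale_lfunE id_lfunE subr_eq0.
by split=> /eqP.
Qed.

Lemma sub_span_free (K : fieldType) (V : vectType K) (N : {vspace V}) (m : nat)
    (f : 'Hom(V, 'rV[K]_m)) (G : seq V) :
    (N :&: lker f = 0)%VS -> free G -> {subset G <= N} -> (m <= size G)%N ->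
  (N <= <<G>>)%VS.
Proof.
move=> Nf0 freeG GN mG.
have dimN : (\dim N <= m)%N.
  rewrite -(limg_dim_eq Nf0) (leq_trans (dimvS (subvf _))) // dimvf.
  by rewrite /dim /= mul1n.
have GsubN : (<<G>> <= N)%VS by apply/span_subvP.
suff /eqP <- : <<G>>%VS == N by [].
rewrite eqEdim GsubN; move: freeG; rewrite /free => /eqP ->.
exact: leq_trans dimN mG.
Qed.

Section Commutation.
Variables (K : fieldType) (n : nat) (t : K).
Hypothesis t0 : t != 0.
Hypothesis q2 : 1 + qq n t ^+ 2 != 0.
Hypothesis two0 : 2 != 0 :> K.
Hypothesis n3 : (2 < n)%N.
Local Notation MM := 'M[K]_(n * n).
Local Notation I := 'I_n.

Lemma tau_act_X s p (T : MM) :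
  tau_RE n t (act t (UX s p) T) = act t (UX s p) (tau_RE n t T).
Proof.
have [u ->] := Theta_surj t0 T.
by rewrite act_Theta // !tau_RE_Theta // act_Theta // opQ_X // opP_X.
Qed.

(** [tau_RE] changes index tuples only by exchanging the V legs, exchanging the V* legs and
    replacing an inner pair (i, i) by another (m, m). A diagonal operator invariant under these
    moves commutes with it; the weights of H_p and q^(H_p/2) are invariant. *)
Lemma tau_opD f (T : MM) :
    (forall j i l k, f j i l k = f l i j k) ->
    (forall j i l k, f j i l k = f j k l i) ->
    (forall j i m k, f j i i k = f j m m k) ->
  tau_RE n t (opD f T) = opD f (tau_RE n t T).
Proof.
move=> f1 f2 f3; have [u ->] := Theta_surj t0 T.
by rewrite -Theta_D // !tau_RE_Theta // opQ_D // opP_D // Theta_D.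
Qed.

Lemma act_H_opD p (T : MM) : act t (UH p) T =
  opD (fun j i l k => hwt K p i - hwt K p j + hwt K p k - hwt K p l) T.
Proof. by apply/entP=> j i l k; rewrite act_H of_entK. Qed.

Lemma act_K_opD s p (T : MM) : act t (UK s p) T =
  opD (fun j i l k => let g := kappa t s p in
    if s then (g i * g k / g j / g l) else (g j * g l / g i / g k)) T.
Proof. by apply/entP=> j i l k; rewrite act_K of_entK. Qed.

Lemma leigenspace_submodule a :
  submodule t (passmx.leigenspace (tau_RE n t) a).
Proof.
apply: submodule_gen => [p T|s p T|s p T] /mem_leigenspace Ta; apply/mem_leigenspace.
- rewrite !act_H_opD tau_opD ?Ta; first by rewrite -!act_H_opD linearZ.
  + by move=> *; ring.
  + by move=> *; ring.
  + by move=> *; ring.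
  rewrite !act_K_opD tau_opD ?Ta; first by rewrite -!act_K_opD linearZ.
  + by move=> * /=; case: (s); field; rewrite ?(kappa_neq0 t0).
  + by move=> * /=; case: (s); field; rewrite ?(kappa_neq0 t0).
  + by move=> * /=; case: (s); field; rewrite ?(kappa_neq0 t0).
- by rewrite tau_act_X Ta linearZ.
Qed.

Definition kerX : {vspace MM} :=
  (\bigcap_(p < n.-1) lker (linfun (act t (UX false p)) : 'End(MM)))%VS.

Lemma mem_kerX v : v \in kerX <-> killed t v.
Proof.
rewrite memvE; split=> [/subv_bigcapP h p|kv].
  by have := h p isT; rewrite -memvE memv_ker lfunE => /eqP.
by apply/subv_bigcapP=> p _; rewrite -memvE memv_ker lfunE /= kv.
Qed.

Definition seed_row h (v : MM) : 'rV[K]_(size (sym_seeds n3 h) + size (alt_seeds n3 h)) :=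
  row_mx
   (\row_(x < size (sym_seeds n3 h))
     let y := nth (ord_1 n3, ord_1 n3) (sym_seeds n3 h) x in
     sym_coord_RE t n3 v y.1 y.2)
   (\row_(x < size (alt_seeds n3 h))
     let y := nth (ord_1 n3, ord_1 n3) (alt_seeds n3 h) x in
     alt_coord_RE t n3 v y.1 y.2).

Fact seed_row_is_linear h : linear (seed_row h).
Proof.
move=> c u v; rewrite /seed_row scale_row_mx add_row_mx; congr row_mx.
  by apply/rowP=> x; rewrite !mxE sym_coord_RE_linear.
by apply/rowP=> x; rewrite !mxE alt_coord_RE_linear.
Qed.
HB.instance Definition _ h :=
  GRing.isLinear.Build K MM _ *:%R (seed_row h) (seed_row_is_linear h).

Lemma kerX_span h (G : seq MM) : free G ->
    (size (sym_seeds n3 h) + size (alt_seeds n3 h) <= size G)%N ->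
    (forall g, g \in G -> killed t g /\ tau_RE n t g = tau_sign K h *: g) ->
  forall v, killed t v -> tau_RE n t v = tau_sign K h *: v -> v \in <<G>>%VS.
Proof.
move=> freeG sizeG Gk v kv tv.
have memN u : killed t u -> tau_RE n t u = tau_sign K h *: u ->
    u \in (kerX :&: passmx.leigenspace (tau_RE n t) (tau_sign K h))%VS.
  by move=> ku tu; rewrite memv_cap; apply/andP; split;
    [apply/mem_kerX|apply/mem_leigenspace].
apply: subvP (memN v kv tv) => {v kv tv}.
apply: (@sub_span_free _ _ _ _ (linfun (seed_row h))) => //; last first.
  by move=> g /Gk[kg tg]; apply: memN.
apply/eqP; rewrite -subv0; apply/subvP=> v; rewrite !memv_cap memv_ker lfunE.
case/andP=> /andP[/mem_kerX kv /mem_leigenspace tv] /eqP; rewrite /= /seed_row -row_mx0.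
case/eq_row_mx => /rowP vS /rowP vL; rewrite memv0; apply/eqP.
apply: (killed_eq0 (n3 := n3) t0 q2 two0 kv tv) => x xin.
  have xlt : (index x (sym_seeds n3 h) < size (sym_seeds n3 h))%N by rewrite index_mem.
  by have := vS (Ordinal xlt); rewrite !mxE /= nth_index.
have xlt : (index x (alt_seeds n3 h) < size (alt_seeds n3 h))%N by rewrite index_mem.
by have := vL (Ordinal xlt); rewrite !mxE /= nth_index.
Qed.

End Commutation.

(** * Complete reducibility *)

Section LowestVector.
Variables (K : fieldType) (n : nat) (t : K).
Local Notation MM := 'M[K]_(n * n).

(* X_p^- raises the height i + k - j - l of the coefficient [ent T j i l k]. *)
Lemma exists_killed (C : {vspace MM}) :
    (forall p T, T \in C -> act t (UX false p) T \in C) -> C != 0%VS ->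
  exists T, [/\ T \in C, T != 0 & killed t T].
Proof.
move=> CX; rewrite -vpick0; move: (vpick C) (memv_pick C) => T TC T0.
pose ht (j i l k : 'I_n) := (i + k + (n - j) + (n - l))%N.
have : forall j i l k, ent T j i l k != 0 -> (4 * n <= 4 * n + ht j i l k)%N.
  by move=> *; rewrite leq_addr.
(* Invariant: nonzero coefficients have height at least 4n - N. Every height is below 4n, so N = 0
   would force T = 0. *)
elim: {2}(4 * n)%N T TC T0 => [|N IH] T TC T0 hT.
  case/eqP: T0; apply/entP=> j i l k; rewrite ent0; apply/eqP.
  by apply: contraT => /hT; rewrite /ht; have := ltn_ord i; have := ltn_ord k; lia.
have [/forallP kT|] := boolP [forall p, act t (UX false p) T == 0].
  by exists T; split=> // p; apply/eqP.
rewrite negb_forall => /existsP[p XT0]; apply: (IH _ (CX p T TC) XT0) => j i l k.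
apply: contraNT => lt_ht; rewrite act_X.
have vanish j' i' l' k' : ht j i l k = (ht j' i' l' k').+1 -> ent T j' i' l' k' = 0.
  by move=> E; apply/eqP; apply: contraNT lt_ht => /hT; lia.
have hp : (p.+1 < n)%N by exact: ltn_ord (hi p).
rewrite /src /=; apply/eqP.
have Z1 : (j == lo p)%:R * ent T (hi p) i l k = 0.
  have [E|] := eqVneq j (lo p); last by rewrite mul0r.
  by rewrite vanish ?mulr0 // /ht E /=; lia.
have Z2 : (i == hi p)%:R * ent T j (lo p) l k = 0.
  have [E|] := eqVneq i (hi p); last by rewrite mul0r.
  by rewrite vanish ?mulr0 // /ht E /=; lia.
have Z3 : (l == lo p)%:R * ent T j i (hi p) k = 0.
  have [E|] := eqVneq l (lo p); last by rewrite mul0r.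
  by rewrite vanish ?mulr0 // /ht E /=; lia.
have Z4 : (k == hi p)%:R * ent T j i l (lo p) = 0.
  have [E|] := eqVneq k (hi p); last by rewrite mul0r.
  by rewrite vanish ?mulr0 // /ht E /=; lia.
have E (x c z : K) : x * z = 0 -> x * c * z = 0.
  by move/eqP; rewrite mulf_eq0 => /orP[] /eqP ->; rewrite ?(mul0r, mulr0).
have E2 (x c c' z : K) : x * z = 0 -> x * c * c' * z = 0.
  by move/(E _ (c * c')); rewrite mulrA.
by rewrite (E2 _ _ _ _ Z1) (E _ _ _ Z2) (E2 _ _ _ _ Z3) (E _ _ _ Z4) !addr0.
Qed.

End LowestVector.

Section Contravariant.
Variables (K : fieldType) (n : nat) (t : K).
Hypothesis t0 : t != 0.
Variable conj : {rmorphism K -> K}.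
Hypothesis conj_t : conj t = t.
Hypothesis conj_pos : forall (J : finType) (x : J -> K),
  \sum_j x j * conj (x j) = 0 -> forall j, x j = 0.
Local Notation MM := 'M[K]_(n * n).
Local Notation q := (qq n t).

Definition dag m (A : 'M[K]_m) : 'M[K]_m := (map_mx conj A)^T.

Lemma dagM m (A B : 'M[K]_m) : dag (A *m B) = dag B *m dag A.
Proof. by rewrite /dag map_mxM trmx_mul. Qed.
Lemma dag_tens m (A B : 'M[K]_m) : dag (A *t B) = dag A *t dag B.
Proof. by rewrite /dag map_mxT trmx_tens. Qed.

(* The weights q^(2j) make the antipodes of X_p^+ and X_p^- adjoint in V*. *)
Definition gram : 'M[K]_n := diag_mx (\row_x q ^+ (2 * x)).

Definition form (S T : MM) : K := \tr (S *m (gram *t gram) *m dag T).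

Lemma formDl S S' T : form (S + S') T = form S T + form S' T.
Proof. by rewrite /form !mulmxDl linearD. Qed.
Lemma formZl c S T : form (c *: S) T = c * form S T.
Proof. by rewrite /form -!scalemxAl linearZ. Qed.
Lemma formDr S T T' : form S (T + T') = form S T + form S T'.
Proof. by rewrite /form /dag map_mxD linearD mulmxDr linearD. Qed.
Lemma formZr S c T : form S (c *: T) = conj c * form S T.
Proof. by rewrite /form /dag map_mxZ linearZ /= -scalemxAr linearZ. Qed.

Lemma conj_qh : conj (qhalf n t) = qhalf n t.
Proof. by rewrite rmorphXn conj_t. Qed.

Lemma conj_kappa_tgt s : conj (kappa_tgt n t s) = kappa_tgt n t s.
Proof. by case: s; rewrite /kappa_tgt ?fmorphV conj_qh. Qed.
Lemma conj_kappa s (p : 'I_n.-1) x : conj (kappa t s p x) = kappa t s p x.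
Proof. by rewrite /kappa; do 2?case: ifP => _;
  rewrite ?fmorphV ?conj_kappa_tgt ?rmorph1. Qed.

(** A square root, fixed by [conj], of the weight of a column of M (x) M. It turns [form T T] into a
    sum of terms x * conj x, to which [conj_pos] applies. *)
Definition gram_root (c : 'I_(n * n)) : K :=
  t ^+ (2 * n * ((mxtens_unindex c).1 + (mxtens_unindex c).2)).

Lemma gram_tens : gram *t gram = diag_mx (\row_c gram_root c ^+ 2).
Proof.
apply/matrixP=> x y; case: (mxtens_indexP x) => i k; case: (mxtens_indexP y) => j l.
rewrite tensmxE !mxE (can_eq (@mxtens_indexK _ _)) xpair_eqE /gram_root !mxtens_indexK /=.
case: eqP => _; case: eqP => _; rewrite ?mul0r ?mulr0 // -!exprM -exprD.
by congr (_ ^+ _); lia.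
Qed.

Lemma form_eq0 T : form T T = 0 -> T = 0.
Proof.
rewrite /form /mxtrace gram_tens => E; apply/matrixP=> r c; rewrite mxE.
suff /(_ (r, c)) /= : forall rc : 'I_(n * n) * 'I_(n * n), T rc.1 rc.2 * gram_root rc.2
  = 0.
  by move/eqP; rewrite mulf_eq0 expf_eq0 (negPf t0) andbF orbF => /eqP.
apply: conj_pos; rewrite -[RHS]E sum_pair; apply: eq_bigr => r' _.
rewrite mxE; apply: eq_bigr => c' _; rewrite mul_mx_diag !mxE /= rmorphM rmorphXn conj_t.
by rewrite -/(gram_root c'); ring.
Qed.

Lemma form_term A A' B B' S T : dag A' = A -> B *m (gram *t gram) = (gram *t gram) *m
  dag B' ->
  form (A *m S *m B) T = form S (A' *m T *m B').
Proof.
move=> EA EB; rewrite /form !dagM EA -!mulmxA mxtrace_mulC -!mulmxA.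
by rewrite [B *m _]mulmxA EB !mulmxA.
Qed.

Definition star (x : uq K n) : uq K n :=
  match x with UX s p => UX (~~ s) p | _ => x end.

(** In the action [rho] multiplies from the left, where [form] is the standard one, and the antipode
    from the right, where [gram] enters; hence the two conditions. *)
Definition adjoint1 (x : uq K n) :=
  dag (rho t (star x)) = rho t x /\
  rho t (antipode t x) *m gram = gram *m dag (rho t (antipode t (star x))).

(** The antipode factors -q^-1 of X_p^+ and -q of X_p^- differ by q^2, the ratio of neighbouring
    weights in [gram]. *)
Lemma adjoint_X s p : adjoint1 (UX s p).
Proof.
split; apply/matrixP=> x y.
  by rewrite !mxE !rho_X rmorphM !rmorph_nat mulrC /src negbK.
rewrite mul_mx_diag mul_diag_mx !mxE !rho_SX !rmorphM rmorphN rmorphXn conj_kappa_tgt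
  !rmorph_nat /= /src negbK.
have [->|_] := eqVneq x; last by rewrite !(mul0r, mulr0).
have [->|_] := eqVneq y; last by rewrite !(mul0r, mulr0).
have Q0 := q_neq0 n t0.
by case: s; rewrite /kappa_tgt ?exprVn (@qh2 _ n t) /= mulnS exprD; field.
Qed.

Lemma adjoint_diag (x : uq K n) (f : 'I_n -> K) (f' : 'I_n -> K) : star x = x ->
  (forall i j, rho t x i j = (j == i)%:R * f i) ->
  (forall i j, rho t (antipode t x) i j = (j == i)%:R * f' i) ->
  (forall i, conj (f i) = f i) -> (forall i, conj (f' i) = f' i) -> adjoint1 x.
Proof.
rewrite /adjoint1 => -> fE f'E fC f'C; split; apply/matrixP=> i j.
  by rewrite !mxE !fE rmorphM rmorph_nat fC eq_sym; have [->|] := eqVneq i j;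
    rewrite ?mul0r.
rewrite mul_mx_diag mul_diag_mx !mxE !f'E rmorphM rmorph_nat f'C [i == j]eq_sym.
by have [->|] := eqVneq j i; rewrite ?(mul0r, mulr0) // mulrC.
Qed.

Lemma form_act_term x1 x2 x3 x4 S T :
    adjoint1 x1 -> adjoint1 x2 -> adjoint1 x3 -> adjoint1 x4 ->
  form ((rho t x2 *t rho t x4) *m S *m (rho t (antipode t x1) *t rho t (antipode t x3))) T
  = form S ((rho t (star x2) *t rho t (star x4)) *m T
      *m (rho t (antipode t (star x1)) *t rho t (antipode t (star x3)))).
Proof.
move=> [_ h1] [h2 _] [_ h3] [h4 _]; apply: form_term; first by rewrite dag_tens h2 h4.
by rewrite dag_tens !tensmx_mul h1 h3.
Qed.

Lemma adjoint_K s p : adjoint1 (UK s p).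
Proof.
pose f s i := if s then kappa t false p i else (kappa t false p i)^-1.
have cf s' i : conj (f s' i) = f s' i.
  by rewrite /f; case: s'; rewrite ?fmorphV conj_kappa.
apply: (@adjoint_diag _ (f s) (f (~~ s))) => //.
- by move=> i j; rewrite rho_K.
- by move=> i j; rewrite /= rho_K.
Qed.

(** Applying [star] in each tensor factor turns the coproduct of X_p^+ into that of X_p^- and
    conversely, with the factors in the same order, so adjointness holds term by term. *)
Lemma form_act_X s p S T :
  form (act t (UX s p) S) T = form S (act t (UX (~~ s) p) T).
Proof.
have aX := adjoint_X s p; have aK s' := adjoint_K s' p.
have D s' : Delta4 (UX s' p : uq K n) =
  [:: ((UX s' p, UK false p), (UK false p, UK false p));
      ((UK true p, UX s' p), (UK false p, UK false p));
      ((UK true p, UK true p), (UX s' p, UK false p));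
      ((UK true p, UK true p), (UK true p, UX s' p))] by [].
rewrite /act !D !big_cons !big_nil !addr0 !formDl !formDr.
by do !congr (_ + _); apply: form_act_term; first [exact: aX | exact: aK].
Qed.

Definition form_row m (b : m.-tuple MM) (S : MM) : 'rV[K]_m := \row_x form S (tnth b x).

Fact form_row_is_linear m b : linear (@form_row m b).
Proof. by move=> c S S'; apply/rowP=> x; rewrite !mxE formDl formZl. Qed.
HB.instance Definition _ m b :=
  GRing.isLinear.Build K MM 'rV[K]_m *:%R (form_row b) (form_row_is_linear b).

(** As the kernel of a map to row vectors of length dim W, the complement has codimension at most
    dim W, whatever the form. *)
Definition orth (W : {vspace MM}) : {vspace MM} :=
  lker (linfun (form_row (vbasis W))).

Lemma mem_orth W S : S \in orth W <-> forall T, T \in W -> form S T = 0.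
Proof.
rewrite memv_ker lfunE /=; split=> [/eqP/rowP h T /coord_vbasis -> | h].
  have f0 (F : 'I_(\dim W) -> K) : form S (\sum_i F i *: (vbasis W)`_i) = 0.
    elim/big_rec: _ => [|i T' _ E];
      first by rewrite -(scale0r (0 : MM)) formZr rmorph0 mul0r.
    have := h i; rewrite !mxE (tnth_nth 0) => h0.
    by rewrite formDr formZr h0 E mulr0 addr0.
  exact: f0.
by apply/eqP/rowP=> i; rewrite !mxE h // vbasis_mem ?mem_tnth.
Qed.

(* Otherwise the orthogonal complement of W :&: W' in W contains a killed vector,
   which lies in W' and is therefore orthogonal to itself. *)
Lemma killed_generate (W W' : {vspace MM}) :
    submodule t W -> submodule t W' ->
    (forall T, T \in W -> killed t T -> T \in W') ->
  (W <= W')%VS.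
Proof.
move=> sW sW' kW; pose W2 := (W :&: W')%VS.
pose C := (W :&: orth W2)%VS.
have sW2 : submodule t W2.
  by move=> x T; rewrite !memv_cap => /andP[TW TW']; rewrite sW ?sW'.
have C0 : C = 0%VS.
  apply/eqP; apply: contraT => C0.
  have [p T|T [TC T0 kT]] := @exists_killed _ _ t C _ C0.
    rewrite !memv_cap => /andP[TW /mem_orth oT]; rewrite sW //=.
    by apply/mem_orth=> T' T'W; rewrite form_act_X oT // sW2.
  case/eqP: T0; apply: form_eq0; move: TC; rewrite memv_cap => /andP[TW /mem_orth].
  by apply; rewrite memv_cap TW kW.
have dimW : (\dim W <= \dim W2)%N.
  have C0' : (W :&: lker (linfun (form_row (vbasis W2))))%VS = 0%VS := C0.
  rewrite -(limg_dim_eq C0').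
  by apply: leq_trans (dimvS (subvf _)) _; rewrite dimvf /dim /= mul1n.
suff /eqP -> : W == W2 by rewrite capvSr.
by rewrite eq_sym eqEdim capvSl.
Qed.

End Contravariant.

(** * The vectors delta_1, ..., delta_10 *)

Lemma doubleS_subn1 (x : nat) : (2 * x.+1 - 1 = (2 * x).+1)%N. Proof. by lia. Qed.

Section CornerFacts.
Variable n : nat.
Hypothesis n3 : (2 < n)%N.
Local Notation i0 := (ord_1 n3).
Local Notation i1 := (ord_2 n3).
Local Notation iM := (ord_prev n3).
Local Notation iN := (ord_last n3).

Lemma succ_eq_last (x : 'I_n) : (x.+1 == n) = (x == iN).
Proof. by rewrite -val_eqE /=; have := ltn_ord x; lia. Qed.
Lemma succ_eq_prev (x : 'I_n) : (x.+1 == n.-1) = (x == iM).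
Proof. by rewrite -val_eqE /=; have := ltn_ord x; lia. Qed.
Lemma succ_eq_1 (x : 'I_n) : (x.+1 == 1%N) = (x == i0). Proof. by []. Qed.
Lemma succ_eq_2 (x : 'I_n) : (x.+1 == 2) = (x == i1). Proof. by []. Qed.

Lemma hi_i0 (p : 'I_n.-1) : (i0 == hi p) = false. Proof. by []. Qed.
Lemma iN_lo (p : 'I_n.-1) : (iN == lo p) = false.
Proof. by rewrite -val_eqE /=; have := ltn_ord p; lia. Qed.

Lemma eq_hi (p : 'I_n.-1) : (i1 == hi p) = (i0 == lo p). Proof. by []. Qed.
Lemma eq_lo (p : 'I_n.-1) : (iM == lo p) = (iN == hi p).
Proof. by rewrite -!val_eqE /=; lia. Qed.

Definition ord_neq : (i0 == i1 = false) * (i1 == i0 = false) * (i0 == iN = false) *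
  (iN == i0 = false) * (i0 == iM = false) * (iM == i0 = false) * (i1 == iN = false) *
  (iN == i1 = false) * (iM == iN = false) * (iN == iM = false).
Proof. by do !split; rewrite -val_eqE /=; lia. Qed.

Lemma ord_neqM : (3 < n)%N -> (i1 == iM = false) * (iM == i1 = false).
Proof. by move=> n4; split; rewrite -val_eqE /=; lia. Qed.

End CornerFacts.

Section Deltas.
Variables (K : fieldType) (n : nat) (t : K).
Hypothesis t0 : t != 0.
Hypothesis n3 : (2 < n)%N.
Local Notation MM := 'M[K]_(n * n).
Local Notation q := (qq n t).
Local Notation w := (omega n t).
Local Notation I := 'I_n.
Local Notation i0 := (ord_1 n3).
Local Notation i1 := (ord_2 n3).
Local Notation iM := (ord_prev n3).
Local Notation iN := (ord_last n3).

(** The entries of the sum of q^(-2i+1) e^i_i, a vector of M* killed by all X_p^-. Indices start at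
    0 here, so the exponent 2i-1 becomes 2j+1. *)
Definition invar (j i : I) : K := (i == j)%:R * q ^- (2 * j).+1.
Definition unit2 (a b : I) (j i : I) : K := (j == a)%:R * (i == b)%:R.

Lemma sum_nat_pick (F : nat -> K) (i : I) :
  (forall m, m != i.+1 -> F m = 0) -> \sum_(1 <= m < n.+1) F m = F i.+1.
Proof.
move=> F0; rewrite (bigD1_seq i.+1) ?iota_uniq ?mem_index_iota ?ltnS ?ltn_ord //=.
by rewrite big1 ?addr0.
Qed.

Lemma e_mxE (a b : nat) (x y : I) : e_ K n a b x y = (x.+1 == a)%:R * (y.+1 == b)%:R.
Proof. by rewrite mxE -natrM mulnb. Qed.

Lemma e_unit2 (x y : I) : (e_ K n n 1 x y = unit2 i0 iN y x) *
  (e_ K n n.-1 1 x y = unit2 i0 iM y x) *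
  (e_ K n n 2 x y = unit2 i1 iN y x) *
  (e_ K n n.-1 2 x y = unit2 i1 iM y x).
Proof. by rewrite !e_mxE succ_eq_last succ_eq_prev succ_eq_1 succ_eq_2 /unit2 !(mulrC
  (x == _)%:R). Qed.

Lemma invar_sum (x y : I) (F : nat -> K -> K) :
  (forall m, F m 0 = 0) ->
  \sum_(1 <= m < n.+1) F m (e_ K n m m x y) = (x == y)%:R * F x.+1 1.
Proof.
move=> F0; rewrite (@sum_nat_pick _ x) => [|m mx].
  rewrite e_mxE eqxx eqSS mul1r eq_sym (inj_eq val_inj).
  by case: eqP; rewrite ?mul1r ?mul0r ?F0.
by rewrite e_mxE eq_sym (negPf mx) mul0r F0.
Qed.

Lemma ent_delta1 j i l k : ent (delta1 n t) j i l k = invar j i * unit2 i0 iN l k.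
Proof.
rewrite ent_sum; under eq_bigr => m _ do rewrite entZ ent_tens e_unit2.
rewrite (invar_sum i j (F := fun m x => q ^- (2 * m - 1) * (x * unit2 i0 iN l k))).
  by rewrite doubleS_subn1 /invar; have [->|_] := eqVneq i j; rewrite ?mul0r // !mul1r.
by move=> m; rewrite mul0r mulr0.
Qed.

Lemma ent_delta2 j i l k : ent (delta2 n t) j i l k = unit2 i0 iN j i * invar l k.
Proof.
rewrite ent_sum; under eq_bigr => m _ do rewrite entZ ent_tens e_unit2.
rewrite (invar_sum k l (F := fun m x => q ^- (2 * m - 1) * (unit2 i0 iN j i * x))).
  by rewrite doubleS_subn1 /invar; have [->|_] := eqVneq k l;
    rewrite ?(mul0r, mulr0) // !mul1r mulr1 mulrC.
by move=> m; rewrite !mulr0.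
Qed.

Lemma ent_delta3 j i l k : ent (delta3 K n) j i l k = unit2 i0 iN j k * (i == l)%:R.
Proof.
rewrite ent_sum; under eq_bigr => m _ do rewrite ent_tens !e_mxE succ_eq_last succ_eq_1.
rewrite (@sum_nat_pick _ i) => [|m mx].
  by rewrite eqxx eqSS (inj_eq val_inj) [l == i]eq_sym /unit2 mul1r; ring.
by rewrite [i.+1 == m]eq_sym (negPf mx) !mul0r.
Qed.

Lemma ent_delta4 j i l k : ent (delta4 n t) j i l k =
  coef4 n t j.+1 * unit2 i0 iN l i * (k == j)%:R.
Proof.
rewrite ent_sum; under eq_bigr => m _ do rewrite entZ ent_tens !e_mxE succ_eq_last
  succ_eq_1.
rewrite (@sum_nat_pick _ j) => [|m mx].
  by rewrite eqxx eqSS (inj_eq val_inj) /unit2 /=; ring.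
by rewrite [j.+1 == m]eq_sym (negPf mx) !(mul0r, mulr0).
Qed.

Lemma ent_delta5 j i l k : ent (delta5 n t) j i l k = invar j i * invar l k.
Proof.
rewrite ent_sum; under eq_bigr => m _.
  rewrite ent_sum; under eq_bigr => m' _ do rewrite entZ ent_tens.
  rewrite (invar_sum k l
    (F := fun m' x => q ^- (2 * m - 1) * q ^- (2 * m' - 1) * (e_ K n m m i j * x))); last first.
    by move=> m'; rewrite !mulr0.
  over.
rewrite (invar_sum i j
  (F := fun m x => (k == l)%:R * (q ^- (2 * m - 1) * q ^- (2 * k.+1 - 1) * (x * 1))));
  last first.
  by move=> m'; rewrite mul0r !mulr0.
by rewrite !doubleS_subn1 /invar; have [->|_] := eqVneq i j; have [->|_] := eqVneq k l;
  rewrite ?(mul0r, mulr0) //=; ring.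
Qed.

Lemma ent_delta6 j i l k : ent (delta6 n t) j i l k = invar j k * (i == l)%:R.
Proof.
rewrite ent_sum (@sum_nat_pick _ j) => [|m mx]; last first.
  rewrite ent_sum big1 // => m' _; rewrite entZ ent_tens !e_mxE.
  by rewrite [j.+1 == m]eq_sym (negPf mx) !(mul0r, mulr0).
rewrite ent_sum (@sum_nat_pick _ i) => [|m mx]; last first.
  by rewrite entZ ent_tens !e_mxE [i.+1 == m]eq_sym (negPf mx) !(mul0r, mulr0).
rewrite entZ ent_tens !e_mxE !eqxx !eqSS !(inj_eq val_inj) doubleS_subn1 /invar.
by rewrite [l == i]eq_sym /=; ring.
Qed.

Lemma ent_delta7 j i l k : ent (delta7 n t) j i l k =
  q * (unit2 i0 iN j i * unit2 i1 iM l k) + q^-1 * (unit2 i1 iM j i * unit2 i0 iN l k)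
  - unit2 i0 iM j i * unit2 i1 iN l k - unit2 i1 iN j i * unit2 i0 iM l k.
Proof. by rewrite !entD !entN !entZ !ent_tens !e_unit2. Qed.

Lemma ent_delta8 j i l k : ent (delta8 K n) j i l k = unit2 i0 iN j i * unit2 i0 iN l k.
Proof. by rewrite ent_tens !e_unit2. Qed.

Lemma ent_delta9 j i l k : ent (delta9 n t) j i l k =
  unit2 i0 iN j i * unit2 i0 iM l k - q^-1 * (unit2 i0 iM j i * unit2 i0 iN l k).
Proof. by rewrite !entD !entN !entZ !ent_tens !e_unit2. Qed.

Lemma ent_delta10 j i l k : ent (delta10 n t) j i l k =
  unit2 i0 iN j i * unit2 i1 iN l k - q^-1 * (unit2 i1 iN j i * unit2 i0 iN l k).
Proof. by rewrite !entD !entN !entZ !ent_tens !e_unit2. Qed.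

Definition ent_delta := (ent_delta1, ent_delta2, ent_delta3, ent_delta4, ent_delta5,
  ent_delta6, ent_delta7, ent_delta8, ent_delta9, ent_delta10).

(** X_p^- on a single factor M*. The action on M* (x) M* follows from it by the coproduct, in
    [act_lower]. *)
Definition act2 (p : 'I_n.-1) (D : I -> I -> K) (j i : I) : K :=
  (j == lo p)%:R * - q * (kappa t false p i)^-1 * D (hi p) i
  + (i == hi p)%:R * (kappa t false p j)^-1 * D j (lo p).

Lemma act_lower p (v : MM) j i l k :
  ent (act t (UX false p) v) j i l k =
    (kappa t false p k)^-1 * (kappa t false p l * act2 p (fun j i => ent v j i l k) j i)
  + (kappa t false p j)^-1 * (kappa t false p i * act2 p (fun l k => ent v j i l k) l k).
Proof. by rewrite act_X /kappa_tgt (@qh2 _ n t) /act2 /src /=; ring. Qed.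

Lemma act2_invar p j i : act2 p invar j i = 0.
Proof.
have Q0 := q_neq0 n t0; have G0 := qh_neq0 n t0.
rewrite /act2 /invar; have [->|nj] := eqVneq j (lo p); have [->|ni] := eqVneq i (hi p);
  rewrite ?mul0r ?addr0 //.
- rewrite !mul1r (kappa_srcE t false p) (kappa_tgtE t false p) /kappa_tgt invrK /=.
  rewrite [(2 * p.+1).+1](_ : _ = (2 + (2 * p).+1)%N); last by lia.
  by rewrite exprD -!(@qh2 _ n t); field; rewrite !expf_neq0.
- by rewrite mulr0.
- by rewrite mulr0 add0r.
Qed.

Lemma act2_unit2 p a b j i : act2 p (unit2 a b) j i =
  (a == hi p)%:R * (- q / kappa t false p b) * unit2 (lo p) b j i
  + (b == lo p)%:R / kappa t false p a * unit2 a (hi p) j i.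
Proof.
rewrite /act2 /unit2 [hi p == a]eq_sym [lo p == b]eq_sym.
have E (x y : I) : (x == y)%:R * (kappa t false p x)^-1 = (x == y)%:R * (kappa t false
  p y)^-1.
  by have [->|_] := eqVneq x y; rewrite ?mul0r.
transitivity ((j == lo p)%:R * - q * (a == hi p)%:R * ((i == b)%:R * (kappa t false p
  i)^-1)
  + (i == hi p)%:R * (b == lo p)%:R * ((j == a)%:R * (kappa t false p j)^-1));
      first by ring.
by rewrite !E; ring.
Qed.

Lemma kappa_unit2 p a b j i : (kappa t false p j)^-1 * (kappa t false p i * unit2 a b j i)
  = kappa t false p b / kappa t false p a * unit2 a b j i.
Proof.
rewrite /unit2; have [->|_] := eqVneq j a; last by rewrite !(mul0r, mulr0).
by have [->|_] := eqVneq i b; [ring|rewrite !mulr0].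
Qed.

Lemma act2_unit2_low p j i : act2 p (unit2 i0 iN) j i = 0.
Proof. by rewrite act2_unit2 hi_i0 iN_lo !mul0r addr0. Qed.

Lemma killed_tens (D L : I -> I -> K) (v : MM) :
    (forall p j i, act2 p D j i = 0) -> (forall p j i, act2 p L j i = 0) ->
    (forall j i l k, ent v j i l k = D j i * L l k) -> killed t v.
Proof.
move=> D0 L0 vE p; apply/entP=> j i l k; rewrite ent0 act_lower.
have -> : act2 p (fun j i => ent v j i l k) j i = act2 p D j i * L l k.
  by rewrite /act2 !vE; ring.
have -> : act2 p (fun l k => ent v j i l k) l k = D j i * act2 p L l k.
  by rewrite /act2 !vE; ring.
by rewrite D0 L0 mul0r !mulr0 addr0.
Qed.

(** The inner legs carry the sum of f^i (x) e_i, on which the two contributions of X_p^- cancel, so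
    only the action on the outer legs [j] and [k] remains. *)
Lemma killed_nested (M : I -> I -> K) (v : MM) :
    (forall p j i, act2 p M j i = 0) ->
    (forall j i l k, ent v j i l k = M j k * (i == l)%:R) -> killed t v.
Proof.
move=> M0 vE p; apply/entP=> j i l k;
  rewrite ent0 act_X /kappa_tgt (@qh2 _ n t) /src /= !vE.
have G0 := qh_neq0 n t0; have g0 x := kappa_neq0 (n := n) t0 false p x.
have E : (i == hi p)%:R * (kappa t false p l * (lo p == l)%:R) = (l == lo p)%:R * q *
  kappa t false p i * (i == hi p)%:R.
  rewrite [lo p == l]eq_sym; have [->|_] := eqVneq i (hi p); last by rewrite mul0r mulr0.
  have [->|_] := eqVneq l (lo p); last by rewrite !(mul0r, mulr0).
  by rewrite (kappa_tgtE t false p) (kappa_srcE t false p) /kappa_tgt -(@qh2 _ n t) /=;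
    field.
have E2 : act2 p M j k * ((i == l)%:R * ((kappa t false p i)^-1 * kappa t false p l)) =
  0 by rewrite M0 mul0r.
transitivity (act2 p M j k * ((i == l)%:R * ((kappa t false p i)^-1 * kappa t false p
  l)) +
   (kappa t false p j)^-1 / kappa t false p k * M j k *
   ((i == hi p)%:R * (kappa t false p l * (lo p == l)%:R) - (l == lo p)%:R * q * kappa
     t false p i * (i == hi p)%:R)).
  have [->|_] := eqVneq i l; last by rewrite /act2 /=; ring.
  by rewrite /act2 /=; field; rewrite !g0.
by rewrite E2 E subrr mulr0 addr0.
Qed.

Lemma killed_delta1 : killed t (delta1 n t).
Proof. exact: (killed_tens act2_invar act2_unit2_low ent_delta1). Qed.
Lemma killed_delta2 : killed t (delta2 n t).
Proof. exact: (killed_tens act2_unit2_low act2_invar ent_delta2). Qed.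
Lemma killed_delta3 : killed t (delta3 K n).
Proof. exact: (killed_nested act2_unit2_low ent_delta3). Qed.
Lemma killed_delta5 : killed t (delta5 n t).
Proof. exact: (killed_tens act2_invar act2_invar ent_delta5). Qed.
Lemma killed_delta6 : killed t (delta6 n t).
Proof. exact: (killed_nested act2_invar ent_delta6). Qed.
Lemma killed_delta8 : killed t (delta8 K n).
Proof. exact: (killed_tens act2_unit2_low act2_unit2_low ent_delta8). Qed.

(** Here the paired legs e_i and f^i are the outer ones, around f^n (x) e_1. The terms with X_p^- on
    the first and on the last leg must cancel, and the coproduct puts powers of q^(H_p/2) on the
    legs in between; this is where the irregular first and last coefficients come from. *)
Lemma killed_delta4 : killed t (delta4 n t).
Proof.
move=> p; apply/entP=> j i l k;
  rewrite ent0 act_X /kappa_tgt (@qh2 _ n t) /src /= !ent_delta4.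
have Q0 := q_neq0 n t0; have G0 := qh_neq0 n t0;
  have g0 x := kappa_neq0 (n := n) t0 false p x.
set g := kappa t false p.
(* Consecutive coefficients have ratio q^-2, except q^-3 at both ends: for the first p the weight of
   e_1 is nontrivial, for the last p that of f^n. Both cannot happen at once, as n > 2. *)
have key : g iN ^+ 2 * coef4 n t p.+1 = q ^+ 2 * g i0 ^+ 2 * coef4 n t p.+2.
  have [E0|n0] := eqVneq i0 (lo p).
    have p0 : p = 0%N :> nat by move/(congr1 val): E0 => /= <-.
    rewrite /g {1}E0 kappa_tgtE kappa_other; last 2 first.
    - by rewrite /= -E0 ord_neq.
    - by rewrite -val_eqE /= p0; lia.
    rewrite /coef4 p0 /= (_ : (2 == n) = false); last by lia.
    by rewrite /kappa_tgt -(@qh2 _ n t); field.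
  have p0 : (p == 0%N :> nat) = false by apply: contraNF n0 => p0;
    rewrite -val_eqE /= eq_sym.
  rewrite [g i0]kappa_other ?hi_i0 ?n0 // /coef4 !eqSS p0.
  have -> : (p.+1 == n) = false by have := ltn_ord p; lia.
  rewrite (_ : (2 * p.+2 - 1)%N = (2 + (2 * p.+1 - 1))%N); last by lia.
  have [EN|nN] := eqVneq iN (hi p).
    have pN : p.+2 = n by move/(congr1 val): EN => /=; lia.
    rewrite {1}EN /g (kappa_srcE t false p) /kappa_tgt pN eqxx (_ : (2 * n)%N = (3 + (2
      * p.+1 - 1))%N) ?exprVn ?(@qh2 _ n t); last by lia.
    by rewrite !exprD (_ : (p.+1 == 0)%N = false) //; field; rewrite !expf_neq0.
  rewrite [g iN]kappa_other ?iN_lo //.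
  have -> : (p.+2 == n) = false by move: nN; rewrite -val_eqE /=; lia.
  by rewrite !exprD (_ : (p.+1 == 0)%N = false) //; field; rewrite !expf_neq0.
rewrite /unit2 [lo p == iN]eq_sym iN_lo [hi p == i0]eq_sym hi_i0.
have [->|_] := eqVneq i iN; last by rewrite /=; ring.
have [->|_] := eqVneq l i0; last by rewrite /=; ring.
have [Ej|_] := eqVneq j (lo p); last by rewrite /=; ring.
have [Ek|_] := eqVneq k (hi p); last by rewrite /=; ring.
rewrite Ej Ek /= -/g [g (lo p)](kappa_tgtE t false p) [g (hi p)](kappa_srcE t false p)
  /kappa_tgt.
transitivity ((g iN ^+ 2 * coef4 n t p.+1 - q ^+ 2 * g i0 ^+ 2 * coef4 n t p.+2)
  / (qhalf n t * g iN * g i0)); last by rewrite key subrr mul0r.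
by rewrite -!(@qh2 _ n t); field; rewrite !g0 G0 oner_neq0.
Qed.

Definition tens2 (a b c d : I) : MM :=
  of_ent (fun j i l k => unit2 a b j i * unit2 c d l k).

Lemma act_tens2 p a b c d : let g := kappa t false p in
  act t (UX false p) (tens2 a b c d) =
    (g c / g d) *: ((a == hi p)%:R * (- q / g b) *: tens2 (lo p) b c d
                    + (b == lo p)%:R / g a *: tens2 a (hi p) c d)
    + (g b / g a) *: ((c == hi p)%:R * (- q / g d) *: tens2 a b (lo p) d
                    + (d == lo p)%:R / g c *: tens2 a b c (hi p)).
Proof.
move=> g; apply/entP=> j i l k; rewrite act_lower !(entD, entZ) !of_entK.
have -> : act2 p (fun j i => ent (tens2 a b c d) j i l k) j i = act2 p (unit2 a b) j i
  * unit2 c d l k.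
  by rewrite /act2 !of_entK; ring.
have -> : act2 p (fun l k => ent (tens2 a b c d) j i l k) l k = unit2 a b j i * act2 p
  (unit2 c d) l k.
  by rewrite /act2 !of_entK; ring.
have E : (g k)^-1 * (g l * unit2 c d l k) = g c / g d * unit2 c d l k.
  rewrite /unit2; have [->|_] := eqVneq l c; last by rewrite !(mul0r, mulr0).
  by have [->|_] := eqVneq k d; [ring|rewrite !mulr0].
transitivity (act2 p (unit2 a b) j i * ((g k)^-1 * (g l * unit2 c d l k)) +
  act2 p (unit2 c d) l k * ((g j)^-1 * (g i * unit2 a b j i))); first by rewrite -/g;
    ring.
by rewrite E kappa_unit2 -/g !act2_unit2 -/g; ring.
Qed.

Lemma delta7_tens2 : delta7 n t = q *: tens2 i0 iN i1 iM + q^-1 *: tens2 i1 iM i0 iN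
  - tens2 i0 iM i1 iN - tens2 i1 iN i0 iM.
Proof. by apply/entP=> j i l k; rewrite ent_delta7 !(entD, entN, entZ) !of_entK. Qed.
Lemma delta9_tens2 : delta9 n t = tens2 i0 iN i0 iM - q^-1 *: tens2 i0 iM i0 iN.
Proof. by apply/entP=> j i l k; rewrite ent_delta9 !(entD, entN, entZ) !of_entK. Qed.
Lemma delta10_tens2 : delta10 n t = tens2 i0 iN i1 iN - q^-1 *: tens2 i1 iN i0 iN.
Proof. by apply/entP=> j i l k; rewrite ent_delta10 !(entD, entN, entZ) !of_entK. Qed.

Lemma kappa_fst p : iN = hi p -> kappa t false p i0 = 1.
Proof.
move=> EN; rewrite kappa_other ?hi_i0 //= -(inj_eq val_inj) /=.
by move/(congr1 val): EN => /=; lia.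
Qed.
Lemma kappa_last p : iN = hi p -> kappa t false p iN = (qhalf n t)^-1.
Proof. by move=> ->; apply: kappa_srcE. Qed.
Lemma kappa_fst' p : i0 = lo p -> kappa t false p i0 = qhalf n t.
Proof. by move=> ->; apply: kappa_tgtE. Qed.
Lemma kappa_snd' p : i0 = lo p -> kappa t false p i1 = (qhalf n t)^-1.
Proof. by move=> /eqP; rewrite -eq_hi => /eqP ->; apply: kappa_srcE. Qed.
Lemma kappa_last' p : i0 = lo p -> kappa t false p iN = 1.
Proof.
move=> E0; rewrite kappa_other ?iN_lo //= -(inj_eq val_inj) /=.
by move/(congr1 val): E0 => /=; lia.
Qed.

Lemma killed_delta9 : killed t (delta9 n t).
Proof.
have Q0 := q_neq0 n t0; have G0 := qh_neq0 n t0.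
move=> p; rewrite delta9_tens2 linearB linearZ /= !act_tens2.
apply/entP=> j i l k; rewrite !(ent0, entD, entN, entZ).
rewrite !hi_i0 !iN_lo eq_lo; have [EN|_] := eqVneq iN (hi p); last by rewrite /=; ring.
rewrite -!EN kappa_fst // kappa_last // /= -(@qh2 _ n t).
by field; rewrite ?G0 ?oner_neq0 ?(kappa_neq0 t0).
Qed.

Lemma killed_delta10 : killed t (delta10 n t).
Proof.
have Q0 := q_neq0 n t0; have G0 := qh_neq0 n t0.
move=> p; rewrite delta10_tens2 linearB linearZ /= !act_tens2.
apply/entP=> j i l k; rewrite !(ent0, entD, entN, entZ).
rewrite !hi_i0 !iN_lo eq_hi; have [E0|_] := eqVneq i0 (lo p); last by rewrite /=; ring.
rewrite -!E0 kappa_fst' // kappa_snd' // kappa_last' // /= -(@qh2 _ n t).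
by field; rewrite ?G0 ?oner_neq0 ?(kappa_neq0 t0).
Qed.

(** Only the first and the last X_p^- can act on these indices. For n > 3 the indices 2 and n-1
    differ, so the first one meets weight 1 at n-1 and the last one meets weight 1 at 2; then the
    four terms cancel in pairs. *)
Lemma killed_delta7 : (3 < n)%N -> killed t (delta7 n t).
Proof.
move=> n4; have Q0 := q_neq0 n t0; have G0 := qh_neq0 n t0.
move=> p; rewrite delta7_tens2 linearB linearB linearD !linearZ /= !act_tens2.
apply/entP=> j i l k; rewrite !(ent0, entD, entN, entZ).
rewrite !hi_i0 !iN_lo !eq_hi !eq_lo.
have [E0|_] := eqVneq i0 (lo p); have [EN|_] := eqVneq iN (hi p).
- by exfalso; move/(congr1 val): E0; move/(congr1 val): EN => /=; lia.
- have gM : kappa t false p iM = 1.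
    by rewrite kappa_other //= -(inj_eq val_inj) /=; move/(congr1 val): E0 => /=; lia.
  rewrite -!E0 kappa_fst' // kappa_snd' // kappa_last' // gM /= -(@qh2 _ n t).
  by field; rewrite ?G0 ?oner_neq0 ?(kappa_neq0 t0).
- have gM : kappa t false p iM = qhalf n t.
    have /eqP : iN = hi p by []; rewrite -eq_lo => /eqP ->; exact: kappa_tgtE.
  have g1 : kappa t false p i1 = 1.
    by rewrite kappa_other //= -(inj_eq val_inj) /=; move/(congr1 val): EN => /=; lia.
  rewrite -!EN kappa_fst // kappa_last // g1 gM /= -(@qh2 _ n t).
  by field; rewrite ?G0 ?oner_neq0 ?(kappa_neq0 t0).
- by rewrite /=; ring.
Qed.

Definition has_wt (f : 'I_n.-1 -> K) (T : MM) := forall p, act t (UH p) T = f p *: T.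

Lemma has_wt_ent f (T : MM) :
  (forall p j i l k, (hwt K p i - hwt K p j + hwt K p k - hwt K p l) * ent T j i l k
     = f p * ent T j i l k) -> has_wt f T.
Proof. by move=> h p; apply/entP=> j i l k; rewrite act_H entZ h. Qed.

Lemma has_wtD f S T : has_wt f S -> has_wt f T -> has_wt f (S + T).
Proof. by move=> hS hT p; rewrite linearD /= hS hT scalerDr. Qed.
Lemma has_wtZ f c T : has_wt f T -> has_wt f (c *: T).
Proof. by move=> hT p; rewrite linearZ /= hT !scalerA mulrC. Qed.
Lemma has_wtN f T : has_wt f T -> has_wt f (- T).
Proof. by move=> hT; rewrite -scaleN1r; apply: has_wtZ. Qed.

Lemma killedD (S T : MM) : killed t S -> killed t T -> killed t (S + T).
Proof. by move=> hS hT p; rewrite linearD /= hS hT addr0. Qed.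
Lemma killedZ c (T : MM) : killed t T -> killed t (c *: T).
Proof. by move=> hT p; rewrite linearZ /= hT scaler0. Qed.
Lemma killedN (T : MM) : killed t T -> killed t (- T).
Proof. by move=> hT; rewrite -scaleN1r; apply: killedZ. Qed.

Definition wt1 p := hwt K p iN - hwt K p i0.

Lemma has_wt_delta1 : has_wt wt1 (delta1 n t).
Proof.
apply: has_wt_ent => p j i l k; rewrite ent_delta1 /invar /unit2 /wt1.
have [->|_] := eqVneq i j; last by rewrite !(mul0r, mulr0).
have [->|_] := eqVneq l i0; last by rewrite !(mul0r, mulr0).
have [->|_] := eqVneq k iN; last by rewrite !(mul0r, mulr0).
ring.
Qed.
Lemma has_wt_delta2 : has_wt wt1 (delta2 n t).
Proof.
apply: has_wt_ent => p j i l k; rewrite ent_delta2 /invar /unit2 /wt1.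
have [->|_] := eqVneq k l; last by rewrite !(mul0r, mulr0).
have [->|_] := eqVneq j i0; last by rewrite !(mul0r, mulr0).
have [->|_] := eqVneq i iN; last by rewrite !(mul0r, mulr0).
ring.
Qed.
Lemma has_wt_delta3 : has_wt wt1 (delta3 K n).
Proof.
apply: has_wt_ent => p j i l k; rewrite ent_delta3 /invar /unit2 /wt1.
have [->|_] := eqVneq i l; last by rewrite !(mul0r, mulr0).
have [->|_] := eqVneq j i0; last by rewrite !(mul0r, mulr0).
have [->|_] := eqVneq k iN; last by rewrite !(mul0r, mulr0).
ring.
Qed.
Lemma has_wt_delta4 : has_wt wt1 (delta4 n t).
Proof.
apply: has_wt_ent => p j i l k; rewrite ent_delta4 /invar /unit2 /wt1.
have [->|_] := eqVneq k j; last by rewrite !(mul0r, mulr0).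
have [->|_] := eqVneq l i0; last by rewrite !(mul0r, mulr0).
have [->|_] := eqVneq i iN; last by rewrite !(mul0r, mulr0).
ring.
Qed.
Lemma has_wt_delta5 : has_wt (fun=> 0) (delta5 n t).
Proof.
apply: has_wt_ent => p j i l k; rewrite ent_delta5 /invar.
have [->|_] := eqVneq i j; last by rewrite !(mul0r, mulr0).
have [->|_] := eqVneq k l; last by rewrite !(mul0r, mulr0).
ring.
Qed.
Lemma has_wt_delta6 : has_wt (fun=> 0) (delta6 n t).
Proof.
apply: has_wt_ent => p j i l k; rewrite ent_delta6 /invar.
have [->|_] := eqVneq i l; last by rewrite !(mul0r, mulr0).
have [->|_] := eqVneq k j; last by rewrite !(mul0r, mulr0).
ring.
Qed.

Lemma has_wt_tens2 a b c d (f : 'I_n.-1 -> K) :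
  (forall p, f p = hwt K p b - hwt K p a + hwt K p d - hwt K p c) -> has_wt f (tens2 a
    b c d).
Proof.
move=> fE; apply: has_wt_ent => p j i l k; rewrite of_entK /unit2 fE.
have [->|_] := eqVneq j a; last by rewrite !(mul0r, mulr0).
have [->|_] := eqVneq i b; last by rewrite !(mul0r, mulr0).
have [->|_] := eqVneq l c; last by rewrite !(mul0r, mulr0).
by have [->|_] := eqVneq k d; last by rewrite !(mul0r, mulr0).
Qed.

Lemma has_wt_delta7 :
  has_wt (fun p => hwt K p iN - hwt K p i0 + hwt K p iM - hwt K p i1) (delta7 n t).
Proof.
rewrite delta7_tens2; do ![apply: has_wtD | apply: has_wtN | apply: has_wtZ];
  by apply: has_wt_tens2 => p; ring.
Qed.
Lemma delta8_tens2 : delta8 K n = tens2 i0 iN i0 iN.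
Proof. by apply/entP=> j i l k; rewrite ent_delta8 of_entK. Qed.
Lemma has_wt_delta8 : has_wt (fun p => wt1 p + wt1 p) (delta8 K n).
Proof. by rewrite delta8_tens2; apply: has_wt_tens2 => p; rewrite /wt1; ring. Qed.
Lemma has_wt_delta9 : has_wt (fun p => wt1 p + hwt K p iM - hwt K p i0) (delta9 n t).
Proof.
rewrite delta9_tens2; do ![apply: has_wtD | apply: has_wtN | apply: has_wtZ];
  by apply: has_wt_tens2 => p; rewrite /wt1; ring.
Qed.
Lemma has_wt_delta10 : has_wt (fun p => wt1 p + hwt K p iN - hwt K p i1) (delta10 n t).
Proof.
rewrite delta10_tens2; do ![apply: has_wtD | apply: has_wtN | apply: has_wtZ];
  by apply: has_wt_tens2 => p; rewrite /wt1; ring.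
Qed.

Lemma sym_gens_weights T : T \in sym_generators n t ->
  (exists f, has_wt f T) /\ killed t T.
Proof.
have [[[k1 k2] k3] k4] := (killed_delta1, killed_delta2, killed_delta3, killed_delta4).
have [[[h1 h2] h3] h4] := (has_wt_delta1, has_wt_delta2, has_wt_delta3, has_wt_delta4).
rewrite /sym_generators !mem_cat => /or3P[]; first rewrite !inE => /or4P[] /eqP->.
- split; first by exists wt1; do ![apply: has_wtD | apply: has_wtZ].
  by do ![apply: killedD | apply: killedZ].
- split; first by exists wt1; do ![apply: has_wtD | apply: has_wtN | apply: has_wtZ].
  by do ![apply: killedD | apply: killedN | apply: killedZ].
- by split; [eexists; apply: has_wt_delta5|apply: killed_delta5].
- by split; [eexists; apply: has_wt_delta6|apply: killed_delta6].
- case: ifP => // n4; rewrite inE => /eqP->.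
  by split; [eexists; apply: has_wt_delta7|apply: killed_delta7].
- by rewrite inE => /eqP->; split; [eexists; apply: has_wt_delta8|apply: killed_delta8].
Qed.

Lemma antisym_gens_weights T : T \in antisym_generators n t ->
  (exists f, has_wt f T) /\ killed t T.
Proof.
have [[[k1 k2] k3] k4] := (killed_delta1, killed_delta2, killed_delta3, killed_delta4).
have [[[h1 h2] h3] h4] := (has_wt_delta1, has_wt_delta2, has_wt_delta3, has_wt_delta4).
rewrite !inE => /or4P[] /eqP->.
- split; first by exists wt1; apply: has_wtD => //; apply: has_wtN.
  by apply: killedD => //; apply: killedN.
- split; first by exists wt1; apply: has_wtD => //; apply: has_wtN.
  by apply: killedD => //; apply: killedN.
- by split; [eexists; apply: has_wt_delta9|apply: killed_delta9].
- by split; [eexists; apply: has_wt_delta10|apply: killed_delta10].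
Qed.

End Deltas.

(** * Eigenvalues and linear independence of the generators *)

Section EigenGenerators.
Variables (K : fieldType) (n : nat) (t : K).
Hypothesis t0 : t != 0.
Hypothesis q2 : 1 + qq n t ^+ 2 != 0.
Hypothesis two0 : 2 != 0 :> K.
Hypothesis n3 : (2 < n)%N.
Local Notation MM := 'M[K]_(n * n).
Local Notation q := (qq n t).
Local Notation w := (omega n t).
Local Notation I := 'I_n.
Local Notation i0 := (ord_1 n3).
Local Notation i1 := (ord_2 n3).
Local Notation iM := (ord_prev n3).
Local Notation iN := (ord_last n3).

Lemma coef4_1 : coef4 n t 1 = 1. Proof. by []. Qed.
Lemma coef4_2 : coef4 n t 2 = q ^- 3.
Proof. by rewrite /coef4 /= ltn_eqF. Qed.

Let entries := (@entD K n, @entN K n, @entZ K n, ent_delta t n3).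

(** By [tau_criterion] it suffices to inspect each generator at the seeds of the eigenvalue -1. *)
Lemma tau_sym_generators T : T \in sym_generators n t -> tau_RE n t T = T.
Proof.
have Q0 := q_neq0 n t0.
move=> TG; have [_ kT] := sym_gens_weights t0 n3 TG.
rewrite -[RHS](scale1r T) -[1]/(tau_sign K true);
  apply: (tau_criterion t0 q2 two0 (n3 := n3)) => //.
- move=> x; rewrite /sym_seeds !inE => /orP[] /eqP-> {kT} /=;
    rewrite /exchanged ?ord_neq /sym_coord_RE ?ord_neq ?eqxx;
  move: TG; rewrite /sym_generators !mem_cat => /or3P[]; rewrite ?inE.
  + by case/or4P=> /eqP->; rewrite !entries /invar /unit2 ?ord_neq ?eqxx ?coef4_1
      ?coef4_2 /= /omega ?muln0 ?muln1; field; rewrite ?Q0 ?expf_neq0.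
  + case: ifP => // n4; rewrite inE => /eqP->.
    by rewrite !entries /invar /unit2 ?ord_neq ?(ord_neqM n3 n4) ?eqxx /=; field;
      rewrite ?Q0.
  + by move=> /eqP->; rewrite !entries /unit2 ?ord_neq ?eqxx /=; field.
  + by case/or4P=> /eqP->; rewrite !entries /invar /unit2 ?ord_neq ?eqxx ?coef4_1
      ?coef4_2 /= /omega ?muln0 ?muln1; field; rewrite ?Q0 ?expf_neq0.
  + case: ifP => // n4; rewrite inE => /eqP->.
    by rewrite !entries /invar /unit2 ?ord_neq ?(ord_neqM n3 n4) ?eqxx /=; field;
      rewrite ?Q0.
  + by move=> /eqP->; rewrite !entries /unit2 ?ord_neq ?eqxx /=; field.
- move=> x; rewrite /alt_seeds !inE => /orP[] /eqP-> {kT} /=;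
    rewrite /exchanged ?eqxx ?ord_neq /=; last right;
  rewrite /alt_coord_RE ?ord_neq ?eqxx;
  move: TG; rewrite /sym_generators !mem_cat => /or3P[]; rewrite ?inE.
  + by case/or4P=> /eqP->; rewrite !entries /invar /unit2 ?ord_neq ?eqxx ?coef4_1
      ?coef4_2 /= /omega ?muln0 ?muln1; field; rewrite ?Q0 ?expf_neq0.
  + case: ifP => // n4; rewrite inE => /eqP->.
    by rewrite !entries /invar /unit2 ?ord_neq ?(ord_neqM n3 n4) ?eqxx /=; field;
      rewrite ?Q0.
  + by move=> /eqP->; rewrite !entries /unit2 ?ord_neq ?eqxx /=; field; rewrite ?Q0.
  + by case/or4P=> /eqP->; rewrite !entries /invar /unit2 ?ord_neq ?eqxx ?coef4_1
      ?coef4_2 /= /omega ?muln0 ?muln1; field; rewrite ?Q0 ?expf_neq0.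
  + case: ifP => // n4; rewrite inE => /eqP->.
    by rewrite !entries /invar /unit2 ?ord_neq ?(ord_neqM n3 n4) ?eqxx /=; field;
      rewrite ?Q0.
  + by move=> /eqP->; rewrite !entries /unit2 ?ord_neq ?eqxx /=; field.
Qed.

Lemma tau_antisym_generators T : T \in antisym_generators n t -> tau_RE n t T = - T.
Proof.
have Q0 := q_neq0 n t0.
move=> TG; have [_ kT] := antisym_gens_weights t0 n3 TG.
rewrite -scaleN1r -[-1]/(tau_sign K false);
  apply: (tau_criterion t0 q2 two0 (n3 := n3)) => //.
- move=> x; rewrite /sym_seeds !inE => /or3P[] /eqP-> {kT} /=;
    rewrite /exchanged ?eqxx ?ord_neq /=;
  [|right|right]; rewrite /sym_coord_RE ?ord_neq ?eqxx;
  move: TG; rewrite !inE => /or4P[] /eqP->;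
    rewrite !entries /invar /unit2 ?ord_neq ?eqxx ?coef4_1 ?coef4_2 /= /omega ?muln0
    ?muln1;
  by field; rewrite ?Q0 ?expf_neq0.
- move=> x; rewrite /alt_seeds mem_cat => /orP[|].
    rewrite !inE => /orP[] /eqP-> {kT} /=; rewrite /exchanged ?eqxx ?ord_neq /=;
    rewrite /alt_coord_RE ?ord_neq ?eqxx;
    move: TG; rewrite !inE => /or4P[] /eqP->;
      rewrite !entries /invar /unit2 ?ord_neq ?eqxx ?coef4_1 ?coef4_2 /= /omega ?muln0
      ?muln1;
    by field; rewrite ?Q0 ?expf_neq0.
  case: ifP => // n4; rewrite inE => /eqP->; rewrite /exchanged /= ?ord_neq /=;
  rewrite /alt_coord_RE ?ord_neq ?(ord_neqM n3 n4) ?eqxx;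
  move: TG; rewrite !inE => /or4P[] /eqP->;
    rewrite !entries /invar /unit2 ?ord_neq ?(ord_neqM n3 n4) ?eqxx ?coef4_1 ?coef4_2
    /= /omega ?muln0 ?muln1;
  by field; rewrite ?Q0 ?expf_neq0.
Qed.

Definition entl (j i l k : I) (T : MM) : K^o := ent T j i l k.
Fact entl_is_linear j i l k : linear (entl j i l k).
Proof. by move=> c S T; rewrite /entl entD entZ. Qed.
HB.instance Definition _ j i l k :=
  GRing.isLinear.Build K MM K^o *:%R (entl j i l k) (entl_is_linear j i l k).

Lemma notin_span j i l k (G : seq MM) (T : MM) :
    all (fun S => ent S j i l k == 0) G -> ent T j i l k != 0 ->
  T \notin <<G>>%VS.
Proof.
move=> /allP G0; apply: contraNN => TG.
have sub : (<<G>> <= lker (linfun (entl j i l k)))%VS.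
  by apply/span_subvP=> S /G0; rewrite memv_ker lfunE.
by move/subvP: sub => /(_ T TG); rewrite memv_ker lfunE.
Qed.

(** For each generator a coefficient is chosen at which it is nonzero and all later generators
    vanish. *)
Lemma free_antisym : free (antisym_generators n t).
Proof.
have Q0 := q_neq0 n t0; have Qe m : q ^+ m != 0 by rewrite expf_neq0.
rewrite /antisym_generators !free_cons nil_free andbT; apply/and4P; split.
- by apply: (@notin_span i1 i1 i0 iN);
  rewrite /= ?entries /invar /unit2 ?ord_neq ?eqxx /= ?coef4_2
    ?(mul0r, mulr0, mul1r, mulr1, subr0, addr0, oppr0, sub0r, add0r)
    ?(eqxx, oppr_eq0, invr_eq0, mulf_eq0, oner_eq0) ?Qe ?Q0 ?(negPf Q0) //.
- by apply: (@notin_span i1 iN i0 i1);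
  rewrite /= ?entries /invar /unit2 ?ord_neq ?eqxx /= ?coef4_2
    ?(mul0r, mulr0, mul1r, mulr1, subr0, addr0, oppr0, sub0r, add0r)
    ?(eqxx, oppr_eq0, invr_eq0, mulf_eq0, oner_eq0) ?Qe ?Q0 ?(negPf Q0) //.
- by apply: (@notin_span i0 iN i0 iM);
  rewrite /= ?entries /invar /unit2 ?ord_neq ?eqxx /= ?coef4_2
    ?(mul0r, mulr0, mul1r, mulr1, subr0, addr0, oppr0, sub0r, add0r)
    ?(eqxx, oppr_eq0, invr_eq0, mulf_eq0, oner_eq0) ?Qe ?Q0 ?(negPf Q0) //.
- by apply: (@notin_span i0 iN i1 iN);
  rewrite /= ?entries /invar /unit2 ?ord_neq ?eqxx /= ?coef4_2
    ?(mul0r, mulr0, mul1r, mulr1, subr0, addr0, oppr0, sub0r, add0r)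
    ?(eqxx, oppr_eq0, invr_eq0, mulf_eq0, oner_eq0) ?Qe ?Q0 ?(negPf Q0) //.
Qed.

Lemma free_sym : free (sym_generators n t).
Proof.
have Q0 := q_neq0 n t0; have Qe m : q ^+ m != 0 by rewrite expf_neq0.
have free8 : free [:: delta8 K n].
  by rewrite free_cons nil_free andbT; apply: (@notin_span i0 iN i0 iN);
  rewrite /= ?entries /invar /unit2 ?ord_neq ?eqxx /= ?coef4_2
    ?(mul0r, mulr0, mul1r, mulr1, subr0, addr0, oppr0, sub0r, add0r)
    ?(eqxx, oppr_eq0, invr_eq0, mulf_eq0, oner_eq0) ?Qe ?Q0 ?(negPf Q0) //.
have free7 : free ((if (3 < n)%N then [:: delta7 n t] else [::]) ++ [:: delta8 K n]).
  case: ifP => n4 //=; rewrite free_cons free8 andbT; apply: (@notin_span i0 iN i1 iM);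
  rewrite /= ?entries /invar /unit2 ?ord_neq ?(ord_neqM n3 n4) ?eqxx /= ?coef4_2
    ?(mul0r, mulr0, mul1r, mulr1, subr0, addr0, oppr0, sub0r, add0r)
    ?(eqxx, oppr_eq0, invr_eq0, mulf_eq0, oner_eq0) ?Qe ?Q0 ?(negPf Q0) //.
rewrite /sym_generators /= !free_cons free7 andbT; apply/and4P.
case: ifP => n4; split.
- by apply: (@notin_span i1 i1 i0 iN);
  rewrite /= ?entries /invar /unit2 ?ord_neq ?(ord_neqM n3 n4) ?eqxx /= ?coef4_2
    ?(mul0r, mulr0, mul1r, mulr1, subr0, addr0, oppr0, sub0r, add0r)
    ?(eqxx, oppr_eq0, invr_eq0, mulf_eq0, oner_eq0) ?Qe ?Q0 ?(negPf Q0) //.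
- by apply: (@notin_span i1 iN i0 i1);
  rewrite /= ?entries /invar /unit2 ?ord_neq ?(ord_neqM n3 n4) ?eqxx /= ?coef4_2
    ?(mul0r, mulr0, mul1r, mulr1, subr0, addr0, oppr0, sub0r, add0r)
    ?(eqxx, oppr_eq0, invr_eq0, mulf_eq0, oner_eq0) ?Qe ?Q0 ?(negPf Q0) //.
- by apply: (@notin_span i0 i0 i1 i1);
  rewrite /= ?entries /invar /unit2 ?ord_neq ?(ord_neqM n3 n4) ?eqxx /= ?coef4_2
    ?(mul0r, mulr0, mul1r, mulr1, subr0, addr0, oppr0, sub0r, add0r)
    ?(eqxx, oppr_eq0, invr_eq0, mulf_eq0, oner_eq0) ?Qe ?Q0 ?(negPf Q0) //.
- by apply: (@notin_span i0 i1 i1 i0);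
  rewrite /= ?entries /invar /unit2 ?ord_neq ?(ord_neqM n3 n4) ?eqxx /= ?coef4_2
    ?(mul0r, mulr0, mul1r, mulr1, subr0, addr0, oppr0, sub0r, add0r)
    ?(eqxx, oppr_eq0, invr_eq0, mulf_eq0, oner_eq0) ?Qe ?Q0 ?(negPf Q0) //.
- by apply: (@notin_span i1 i1 i0 iN);
  rewrite /= ?entries /invar /unit2 ?ord_neq ?eqxx /= ?coef4_2
    ?(mul0r, mulr0, mul1r, mulr1, subr0, addr0, oppr0, sub0r, add0r)
    ?(eqxx, oppr_eq0, invr_eq0, mulf_eq0, oner_eq0) ?Qe ?Q0 ?(negPf Q0) //.
- by apply: (@notin_span i1 iN i0 i1);
  rewrite /= ?entries /invar /unit2 ?ord_neq ?eqxx /= ?coef4_2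
    ?(mul0r, mulr0, mul1r, mulr1, subr0, addr0, oppr0, sub0r, add0r)
    ?(eqxx, oppr_eq0, invr_eq0, mulf_eq0, oner_eq0) ?Qe ?Q0 ?(negPf Q0) //.
- by apply: (@notin_span i0 i0 i1 i1);
  rewrite /= ?entries /invar /unit2 ?ord_neq ?eqxx /= ?coef4_2
    ?(mul0r, mulr0, mul1r, mulr1, subr0, addr0, oppr0, sub0r, add0r)
    ?(eqxx, oppr_eq0, invr_eq0, mulf_eq0, oner_eq0) ?Qe ?Q0 ?(negPf Q0) //.
- by apply: (@notin_span i0 i1 i1 i0);
  rewrite /= ?entries /invar /unit2 ?ord_neq ?eqxx /= ?coef4_2
    ?(mul0r, mulr0, mul1r, mulr1, subr0, addr0, oppr0, sub0r, add0r)
    ?(eqxx, oppr_eq0, invr_eq0, mulf_eq0, oner_eq0) ?Qe ?Q0 ?(negPf Q0) //.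
Qed.

End EigenGenerators.

(** * Conjugation of C(t) *)

Section Fractions.
Variable R : idomainType.
Local Notation "x %:F" := (@tofrac R x).

Lemma frac_repr (x : {fraction R}) : x = (\n_(repr x))%:F / (\d_(repr x))%:F.
Proof.
have d0 : \d_(repr x) != 0 by exact: denom_ratioP.
apply: (canRL (mulfK _)); first by rewrite tofrac_eq0.
rewrite -[X in X * _]reprK; unlock tofrac.
rewrite -[LHS]FracField.pi_mul; apply/eqmodP => /=.
rewrite FracField.equivfE /FracField.mulf !numden_Ratio ?mulf_neq0 ?oner_eq0 //.
by rewrite !mulr1 mulrC.
Qed.

Lemma frac_crossmul (a b c d : R) : b != 0 -> d != 0 ->
  (a%:F / b%:F == c%:F / d%:F) = (a * d == c * b).
Proof.
move=> b0 d0; rewrite -[RHS]tofrac_eq !tofracM.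
by rewrite eqr_div ?tofrac_eq0.
Qed.

End Fractions.

Section FractionMorphism.
Variables (R S : idomainType) (f : {rmorphism R -> S}).

(* Injectivity is an argument so that the ring morphism structure of map_frac can
   be inferred. *)
Definition map_frac of injective f := fun x : {fraction R} =>
  tofrac (f \n_(repr x)) / tofrac (f \d_(repr x)) : {fraction S}.

Hypothesis f_inj : injective f.

(** Two fractions are equal exactly when their cross products agree, and [f] preserves this
    relation; injectivity keeps the denominators nonzero. *)
Lemma map_fracE a b : b != 0 ->
  map_frac f_inj (tofrac a / tofrac b) = tofrac (f a) / tofrac (f b).
Proof.
have f0 c : c != 0 -> f c != 0 by rewrite -(rmorph0 f) (inj_eq f_inj).
move=> b0; rewrite /map_frac; set x := (X in repr X).
have d0 : \d_(repr x) != 0 by [].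
have /eqP := frac_repr x; rewrite {1}/x frac_crossmul // => /eqP E.
by apply/eqP; rewrite frac_crossmul ?f0 // -!rmorphM E.
Qed.

Fact map_frac_is_zmod_morphism : zmod_morphism (map_frac f_inj).
Proof.
have f0 c : c != 0 -> f c != 0 by rewrite -(rmorph0 f) (inj_eq f_inj).
move=> x y; rewrite (frac_repr x) (frac_repr y).
have dx : \d_(repr x) != 0 by []; have dy : \d_(repr y) != 0 by [].
move: dx dy; move: (\n_(repr x)) (\d_(repr x)) (\n_(repr y)) (\d_(repr y)) => a b c d
  b0 d0.
have sub (T : idomainType) (a' b' c' d' : T) : b' != 0 -> d' != 0 ->
    tofrac a' / tofrac b' - tofrac c' / tofrac d' = tofrac (a' * d' - c' * b') / tofrac
      (b' * d').
  move=> b'0 d'0; rewrite tofracB !tofracM -mulNr addf_div ?tofrac_eq0 //.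
  by rewrite mulNr.
by rewrite sub // !map_fracE ?mulf_neq0 // sub ?f0 // !(rmorphB, rmorphM).
Qed.

Fact map_frac_is_monoid_morphism : monoid_morphism (map_frac f_inj).
Proof.
have f0 c : c != 0 -> f c != 0 by rewrite -(rmorph0 f) (inj_eq f_inj).
split=> [|x y].
  by rewrite -[1](divr1 1) -tofrac1 map_fracE ?oner_eq0 // rmorph1 tofrac1 divr1.
rewrite (frac_repr x) (frac_repr y).
have dx : \d_(repr x) != 0 by []; have dy : \d_(repr y) != 0 by [].
move: dx dy; move: (\n_(repr x)) (\d_(repr x)) (\n_(repr y)) (\d_(repr y)) => a b c d
  b0 d0.
by rewrite mulf_div -!tofracM !map_fracE ?mulf_neq0 // !rmorphM mulf_div.
Qed.

HB.instance Definition _ := GRing.isZmodMorphism.Build {fraction R} {fraction S}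
  (map_frac f_inj) map_frac_is_zmod_morphism.
HB.instance Definition _ := GRing.isMonoidMorphism.Build {fraction R} {fraction S}
  (map_frac f_inj) map_frac_is_monoid_morphism.

Lemma map_frac_tofrac a : map_frac f_inj (tofrac a) = tofrac (f a).
Proof. by rewrite -[tofrac a]divr1 -tofrac1 map_fracE ?oner_neq0 // rmorph1 tofrac1
  divr1. Qed.

End FractionMorphism.

Section Conjugation.
Variable C : numClosedFieldType.
Local Notation K := {fraction {poly C}}.

Lemma conj_poly_inj : injective (map_poly (@Num.conj C)).
Proof. exact/map_poly_inj. Qed.

Definition conj_frac : {rmorphism K -> K} := map_frac conj_poly_inj.

(** Once all coefficients below t^m vanish, the coefficient of t^(2m) in the sum is the sum of the
    squared absolute values of the coefficients at t^m. This needs conjugation to fix t. *)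
Lemma sum_conj_poly_eq0 (J : finType) (p : J -> {poly C}) :
  \sum_j p j * map_poly Num.conj (p j) = 0 -> forall j, p j = 0.
Proof.
move=> E j; apply/polyP=> m; rewrite coef0; elim/ltn_ind: m j => m IH.
have := congr1 (fun r : {poly C} => r`_(m + m)) E; rewrite coef_sum coef0.
have Ej j : (p j * map_poly Num.conj (p j))`_(m + m) = `|(p j)`_m| ^+ 2.
  have mm : (m < (m + m).+1)%N by rewrite ltnS leq_addr.
  rewrite coefM (bigD1 (Ordinal mm)) //= big1 => [|a].
    by rewrite addr0 addnK coef_map normCK.
  rewrite -val_eqE /= neq_ltn => /orP[am|ma]; first by rewrite IH ?mul0r.
  rewrite coef_map IH /= ?rmorph0 ?mulr0 //; have := ltn_ord a; lia.
under eq_bigr => j _ do rewrite Ej.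
move=> /eqP; rewrite psumr_eq0 => [/allP h j|j _]; last by rewrite exprn_ge0.
by have := h j (mem_index_enum _); rewrite /= expf_eq0 /= normr_eq0 => /eqP.
Qed.

(** Multiplying every x_j by the common denominator scales the whole sum by this denominator times
    its conjugate, which reduces the claim to polynomials. *)
Lemma sum_conj_frac_eq0 (J : finType) (x : J -> K) :
  \sum_j x j * conj_frac (x j) = 0 -> forall j, x j = 0.
Proof.
pose N j := \n_(repr (x j)); pose D j := \d_(repr (x j)).
have D0 j : D j != 0 by exact: denom_ratioP.
pose p j := N j * \prod_(i | i != j) D i.
have xE j : x j * tofrac (\prod_i D i) = tofrac (p j).
  rewrite (bigD1 j) //= {1}(frac_repr (x j)) !tofracM.
  by rewrite -/(N j) -/(D j) mulrA divfK ?tofrac_eq0 ?D0.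
move=> E j; have /sum_conj_poly_eq0 p0 : \sum_j p j * map_poly Num.conj (p j) = 0.
  apply/eqP; rewrite -tofrac_eq0 rmorph_sum.
  under eq_bigr => i _.
    rewrite /= tofracM -(map_frac_tofrac conj_poly_inj) -/conj_frac -xE rmorphM
      mulrACA; over.
  by rewrite -mulr_suml E mul0r.
have := xE j; rewrite p0 tofrac0 => /eqP; rewrite mulf_eq0 tofrac_eq0.
by rewrite (negPf (_ : \prod_i D i != 0)) ?orbF => [/eqP //|]; apply/prodf_neq0.
Qed.

End Conjugation.

(** * Generation of the eigenspaces *)

Section Generation.
Variables (K : fieldType) (n : nat) (t : K).
Hypothesis t0 : t != 0.
Hypothesis q2 : 1 + qq n t ^+ 2 != 0.
Hypothesis two0 : 2 != 0 :> K.
Hypothesis n3 : (2 < n)%N.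
Variable conj : {rmorphism K -> K}.
Hypothesis conj_t : conj t = t.
Hypothesis conj_pos : forall (J : finType) (x : J -> K),
  \sum_j x j * conj (x j) = 0 -> forall j, x j = 0.
Local Notation MM := 'M[K]_(n * n).

Lemma generates_eigenspace h (G : seq MM) :
    free G -> (size (sym_seeds n3 h) + size (alt_seeds n3 h) <= size G)%N ->
    (forall g, g \in G -> killed t g /\ tau_RE n t g = tau_sign K h *: g) ->
  generates t G (passmx.leigenspace (tau_RE n t) (tau_sign K h)).
Proof.
move=> freeG sizeG GP; split; first exact: leigenspace_submodule.
  by move=> g /GP[_ tg]; apply/mem_leigenspace.
move=> W' sW' GW'; apply: (killed_generate t0 conj_t conj_pos) => //.
  exact: leigenspace_submodule.
move=> T /mem_leigenspace tT kT.
have : T \in <<G>>%VS by apply: kerX_span kT tT.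
by apply/subvP/span_subvP.
Qed.

Lemma lowest_weight_free (G : seq MM) T : free G -> T \in G ->
  (exists f, has_wt t f T) /\ killed t T -> lowest_weight t T.
Proof.
move=> freeG TG [[f hf] kT]; split=> //; last by exists f.
exact: free_not0 TG.
Qed.

End Generation.

Theorem corollary8p2 (R : realType) (n : nat) (hn : (2 < n)%N) :
  [/\ {in sym_generators n (tvar R), forall T, lowest_weight (tvar R) T},
      generates (tvar R) (sym_generators n (tvar R))
        (passmx.leigenspace (tau_RE n (tvar R)) 1%R),
      {in antisym_generators n (tvar R), forall T, lowest_weight (tvar R) T} &
      generates (tvar R) (antisym_generators n (tvar R))
        (passmx.leigenspace (tau_RE n (tvar R)) (-1)%R)].
Proof.
have t0 : tvar R != 0 by rewrite tofrac_eq0 polyX_eq0.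
have two0 : 2 != 0 :> CCt R.
  by rewrite -(rmorph_nat (@tofrac _)) tofrac_eq0 -polyC_natr polyC_eq0 pnatr_eq0.
have conj_t : conj_frac (R[i])%C (tvar R) = tvar R.
  by rewrite /tvar /conj_frac /= map_frac_tofrac /= map_polyX.
have q2 : 1 + qq n (tvar R) ^+ 2 != 0.
  rewrite /qq -exprM -tofracXn -tofrac1 -tofracD tofrac_eq0.
  by rewrite addrC -[1]polyC1 -size_poly_eq0 size_XnaddC //; lia.
have symF := free_sym t0 hn; have antiF := free_antisym t0 hn.
have pos := @sum_conj_frac_eq0 (R[i])%C.
split.
- by move=> T TG; apply: lowest_weight_free symF TG (sym_gens_weights t0 hn TG).
- apply: (generates_eigenspace t0 q2 two0 (n3 := hn) (h := true) conj_t pos) => //.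
    (* Seeds and generators are equal in number: 6 for n > 3 and 5 for n = 3. *)
    by rewrite /sym_generators !size_cat /=; case: ifP.
  move=> g gG; have [_ kg] := sym_gens_weights t0 hn gG.
  by rewrite (tau_sym_generators t0 q2 two0 hn gG) scale1r.
- by move=> T TG; apply: lowest_weight_free antiF TG (antisym_gens_weights t0 hn TG).
- apply: (generates_eigenspace t0 q2 two0 (n3 := hn) (h := false) conj_t pos) => //.
  move=> g gG; have [_ kg] := antisym_gens_weights t0 hn gG.
  by rewrite (tau_antisym_generators t0 q2 two0 hn gG) scaleN1r.
Qed.
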